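(* Let $\mathcal{P}$ be a family of probability distributions on a common measurable space with $\mathsf{D}_{\chi^2}(\mathcal{P})<\infty$, and let $\theta=(\theta_1,\dots,\theta_n)$ be such that $P_{\theta_1},\dots,P_{\theta_n}\in\mathcal{P}$. Let $X_1,\dots,X_n$ be independent with $X_i\sim P_{\theta_i}$, and let $L(\theta,\widehat\theta)=\frac1n\sum_{i=1}^n\ell(\theta_i,\widehat\theta_i)$ with $0\le\ell(\cdot,\cdot)\le M$. Let $$r^{\mathrm{S}}(\theta)=\inf_{\widehat\theta\in\mathcal{D}^{\mathrm{S}}}\mathbb{E}[L(\theta,\widehat\theta)],\qquad r^{\mathrm{PI}}(\theta)=\inf_{\widehat\theta\in\mathcal{D}^{\mathrm{PI}}}\mathbb{E}[L(\theta,\widehat\theta)],$$ where $\mathcal{D}^{\mathrm{S}}$ and $\mathcal{D}^{\mathrm{PI}}$ are the classes of simple and of permutation invariant decision rules. Then $$r^{\mathrm{S}}(\theta)-r^{\mathrm{PI}}(\theta)\le M\sqrt{\frac{6\,\mathsf{D}_{\chi^2}(\mathcal{P})\left(e\,\mathsf{\Delta}_{H^2}(\mathcal{P})\right)^{3\mathsf{C}_{\chi^2}(\mathcal{P})}}{n}}.$$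
   Context: A simple decision rule has the form $\widehat\theta(X)=(\Delta(X_1),\dots,\Delta(X_n))$ for some fixed univariate function $\Delta$ (which may depend on the fixed vector $\theta$, since the infimum is taken for fixed $\theta$). A decision rule $\widehat\theta=\widehat\theta(X_1,\dots,X_n)$ is permutation invariant if $\widehat\theta_{\pi(i)}(X_{\pi(1)},\dots,X_{\pi(n)})=\widehat\theta_i(X_1,\dots,X_n)$ for all $i\in\{1,\dots,n\}$ and all permutations $\pi\in S_n$ — that is, permuting the observations permutes the estimates correspondingly. For probability measures $P,Q$: $\chi^2(P\|Q)=\int\frac{(\mathrm{d}P-\mathrm{d}Q)^2}{\mathrm{d}Q}$, $H^2(P,Q)=\int(\sqrt{\mathrm{d}P}-\sqrt{\mathrm{d}Q})^2$. For the family $\mathcal{P}$: $\mathsf{D}_{\chi^2}(\mathcal{P})=\sup_{P_1,P_2\in\mathcal{P}}\chi^2(P_1\|P_2)$; $\mathsf{C}_{\chi^2}(\mathcal{P})=\sup_{\rho}\mathbb{E}_{P\sim\rho}\left[\chi^2\left(P\,\|\,\mathbb{E}_{P'\sim\rho}[P']\right)\right]$ over all probability distributions (priors) $\rho$ on $\mathcal{P}$; $\mathsf{\Delta}_{H^2}(\mathcal{P})=\left(1-\frac12\sup_{P_1,P_2\in\mathcal{P}}H^2(P_1,P_2)\right)^{-2}$. *)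

(* Defs.v *)
From HB Require Import structures.
From mathcomp Require Import all_boot all_order all_algebra perm.
From mathcomp Require Import all_classical all_reals all_analysis.
From mathcomp Require Import measurable_realfun.

Set Implicit Arguments.
Unset Strict Implicit.
Unset Printing Implicit Defensive.

Import Order.TTheory GRing.Theory Num.Theory.
Import numFieldNormedType.Exports.

Local Open Scope classical_set_scope.
Local Open Scope ring_scope.
Local Open Scope ereal_scope.

Section divergences.
Context (d : measure_display) (T : measurableType d) (R : realType).
Implicit Types P Q : probability T R.

(* P + Q serves as the common dominating measure in the integrals below, whose
   values do not depend on the choice of such a measure. *)
Definition dominating P Q : set T -> \bar R := measure_add P Q.

HB.instance Definition _ P Q := Measure.on (dominating P Q).

Lemma dominating_fin_num P Q : fin_num_fun (dominating P Q).
Proof.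
move=> A mA; rewrite /dominating measure_addE fin_numD.
by rewrite !fin_num_measure.
Qed.

HB.instance Definition _ P Q :=
  @Measure_isFinite.Build d T R (dominating P Q) (dominating_fin_num P Q).

Definition density P Q (S : probability T R) : T -> \bar R :=
  Radon_Nikodym_SigmaFinite.f S (dominating P Q).

(* In \bar R, 0^-1 = +oo and 0 * +oo = 0, so that the integrand is 0 where both
   densities vanish and +oo where only that of Q does: in particular
   chi2 P Q = +oo when P is not dominated by Q. *)
Definition chi2 P Q : \bar R :=
  \int[dominating P Q]_x
    ((density P Q P x - density P Q Q x) ^+ 2 / density P Q Q x).

Definition hellinger2 P Q : \bar R :=
  \int[dominating P Q]_x
    (sqrte (density P Q P x) - sqrte (density P Q Q x)) ^+ 2.

End divergences.

Section mixture.
Context (d : measure_display) (T : measurableType d) (R : realType).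
Variable rho : probability (pprobability T R) R.

Definition mixture (A : set T) : \bar R :=
  \int[rho]_P (P : probability T R) A.

Lemma measurable_eval (A : set T) : measurable A ->
  measurable_fun [set: pprobability T R] (fun P : probability T R => P A).
Proof.
move=> mA.
pose f : pprobability T R -> pprobability T R := id.
have mf : measurable_fun setT f by exact: measurable_id.
exact: (measurable_kernel (kprobability mf) A mA).
Qed.

Let mixture0 : mixture set0 = 0.
Proof. by rewrite /mixture integral0_eq// => P _; rewrite measure0. Qed.

Let mixture_ge0 A : 0 <= mixture A.
Proof. by rewrite /mixture integral_ge0. Qed.

Let mixture_sigma_additive : semi_sigma_additive mixture.
Proof.
move=> F mF tF mUF; rewrite /mixture.
rewrite [X in _ --> X](_ : _ =
    \int[rho]_P \sum_(0 <= k <oo) (P : probability T R) (F k)); last first.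
  apply: eq_integral => P _.
  by apply/esym/cvg_lim => //; exact: measure_semi_sigma_additive.
rewrite integral_nneseries//; last by move=> n; exact: measurable_eval.
by apply: is_cvg_nneseries => n _ _; exact: integral_ge0.
Qed.

HB.instance Definition _ := isMeasure.Build d T R mixture
  mixture0 mixture_ge0 mixture_sigma_additive.

Let mixture_setT : mixture [set: T] = 1.
Proof.
rewrite /mixture -[RHS](@probability_setT _ _ _ rho) -[RHS]mul1e.
rewrite -integral_cst//; apply: eq_integral => P _.
exact: probability_setT.
Qed.

HB.instance Definition _ := Measure_isProbability.Build d T R mixture
  mixture_setT.

End mixture.

Section family_quantities.
Context (d : measure_display) (T : measurableType d) (R : realType).
Variable F : set (probability T R).

Definition chi2_diameter : \bar R :=
  ereal_sup [set chi2 P1 P2 | P1 in F & P2 in F].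

(* F need not be a measurable subset of the space of probability measures: rho
   lives on F when its outer measure of F is 1, i.e., when it is the extension
   of a probability measure on the trace sigma-algebra of F. *)
Definition prior_on (rho : probability (pprobability T R) R) : Prop :=
  forall B : set (pprobability T R), measurable B -> F `<=` B -> rho B = 1.

Definition chi2_capacity : \bar R :=
  ereal_sup
    [set \int[rho]_P chi2 P (mixture rho) | rho in [set rho | prior_on rho]].

(* When F is nonempty and chi2_diameter F < +oo, this and chi2_capacity F are
   finite: chi2_capacity F <= chi2_diameter F by convexity of chi2 in its second
   argument, and 1 - hellinger2 P Q / 2 >= (1 + chi2 P Q)^(-1/2) by Jensen, so
   that hellinger_Delta F <= 1 + chi2_diameter F. *)
Definition hellinger_Delta : \bar R :=
  ((1 - (2^-1)%:E * ereal_sup [set hellinger2 P1 P2 | P1 in F & P2 in F])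
    ^+ 2)^-1.

End family_quantities.

Section compound_decision.
Context (dT dA : measure_display) (T : measurableType dT)
  (A : measurableType dA) (R : realType) (n : nat).

Definition decision_rule := n.-tuple T -> n.-tuple A.
Implicit Types that : decision_rule.

Definition simple_rules : set decision_rule :=
  [set that | exists2 Delta : T -> A,
    measurable_fun setT Delta & forall x, that x = map_tuple Delta x].

Definition permute (S : Type) (s : 'S_n) (x : n.-tuple S) : n.-tuple S :=
  [tuple tnth x (s i) | i < n].

(* Coordinatewise, with that_i the i-th coordinate of that:
   that_i (x_(s 0), ..., x_(s (n-1))) = that_(s i) (x_0, ..., x_(n-1)).
   With s i on the left-hand side instead, simple rules would not qualify (take
   for s a 3-cycle). *)
Definition PI_rules : set decision_rule :=
  [set that | measurable_fun setT that /\
    forall (s : 'S_n) x, that (permute s x) = permute s (that x)].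

Context (Theta : Type) (ell : Theta -> A -> R) (theta : n.-tuple Theta).

Definition compound_loss (a : n.-tuple A) : R :=
  (n%:R^-1 * \sum_(i < n) ell (tnth theta i) (tnth a i))%R.

Context (dO : measure_display) (O : measurableType dO) (Pr : probability O R)
  (X : 'I_n -> {RV Pr >-> T}).

Definition mutually_independent : Prop :=
  forall (J : {set 'I_n}) (B : 'I_n -> set T),
    (forall i, measurable (B i)) ->
    Pr (\bigcap_(i in [set` J]) X i @^-1` B i) =
    \prod_(i in J) Pr (X i @^-1` B i).

Definition risk that : \bar R :=
  'E_Pr[fun w => compound_loss (that [tuple X i w | i < n])].

Definition simple_risk : \bar R := ereal_inf [set risk that | that in simple_rules].

Definition PI_risk : \bar R := ereal_inf [set risk that | that in PI_rules].

End compound_decision.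

(* Main.v *)
From HB Require Import structures.
Require Import Defs.
From mathcomp Require Import all_boot all_order all_algebra perm.
From mathcomp Require Import all_classical all_reals all_analysis.
From mathcomp Require Import measurable_realfun ring lra.

Set Implicit Arguments.
Unset Strict Implicit.
Unset Printing Implicit Defensive.

Import Order.TTheory GRing.Theory Num.Theory.
Import numFieldNormedType.Exports.

Local Open Scope classical_set_scope.
Local Open Scope ring_scope.

(* Let [that] be permutation invariant. Its first component is symmetric in the
   remaining observations, and its risk is the average over i of
   [E ell(theta_i, that_0(X'))], where X' is X with the observations 0 and i
   exchanged. Freezing the observations 1, .., m at random values, independent of
   the argument, makes that_0 a random simple rule, whose risk is the average of
   the same expectations with the law of X' replaced by that of X with X_0
   resampled from P_i. For fixed i the two laws differ only in the i-th
   observation (P_0 against P_i) and, by symmetry, it may be exchanged with the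
   k-th one for any k <> 0: the difference hides among the observations 1, .., m.
   Relative to the law nu under which the i-th observation follows the average
   q of all the P_k, the difference of the densities of the exchanged laws is
   [(dP_k/dq)(x_i) * (dP_0/dP_k - dP_i/dP_k)(x_k)]. These functions of x are
   orthogonal in L2(nu), and their squared norms are bounded by 4 D times
   [int (dP_k/dq)^2 dq], whose sum over k is at most n (1 + C) by the definition
   of the capacity C applied to the uniform prior on the P_k. By Cauchy-Schwarz
   the risks thus differ by at most a multiple of M sqrt(D (1 + C) / n), and
   1 + C <= (e Delta)^(3 C) since Delta >= 1. *)

Local Open Scope ereal_scope.

(** * Densities and change of variables *)

Section densities.
Context (d : measure_display) (T : measurableType d) (R : realType).
Implicit Types (P : probability T R) (Q : {finite_measure set T -> \bar R})
  (L : T -> R) (f : T -> \bar R).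

(** The density is real-valued and nonnegative at every point, so that later algebra on densities is
    pointwise. [Q] is only finite, to cover both probabilities and [dominating P Q]. *)
Definition has_density L P Q :=
  [/\ measurable_fun setT L, (forall t, (0 <= L t)%R) &
  forall A, measurable A -> P A = \int[Q]_(t in A) (L t)%:E].

(** [L] has the same integrals over measurable sets as the Radon-Nikodym derivative, hence agrees
    with it almost everywhere. *)
Lemma density_integral L P Q f : has_density L P Q ->
  measurable_fun setT f -> (forall t, 0 <= f t) ->
  \int[P]_t f t = \int[Q]_t (f t * (L t)%:E).
Proof.
move=> [mL L0 PL] mf f0.
have mEL : measurable_fun setT (EFin \o L) by exact/measurable_EFinP.
have PQ : P `<< Q.
  apply/null_content_dominatesP => A mA QA0; rewrite PL//.
  by apply: null_set_integral => //; exact: measurable_funTS.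
have RNL : ae_eq Q setT (Radon_Nikodym_SigmaFinite.f P Q) (EFin \o L).
  apply: integral_ae_eq => //.
    exact: Radon_Nikodym_SigmaFinite.f_integrable.
  move=> A _ mA.
  exact: etrans (esym (Radon_Nikodym_SigmaFinite.f_integral PQ mA)) (PL _ mA).
rewrite -(Radon_Nikodym_SigmaFinite.change_of_variables PQ)//.
have mRN := measurable_int _ (Radon_Nikodym_SigmaFinite.f_integrable PQ).
apply: ge0_ae_eq_integral => //.
- by apply: emeasurable_funM.
- by apply: emeasurable_funM.
- by move=> t _; rewrite mule_ge0// Radon_Nikodym_SigmaFinite.f_ge0.
- by move=> t _; rewrite mule_ge0// lee_fin.
by apply: filterS RNL => t /(_ I) /= -> _.
Qed.

End densities.

(** * Product laws on tuples: uniqueness, resampling one coordinate, permuting coordinates *)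

Section tuple_laws.
Context (d : measure_display) (T : measurableType d) (R : realType) (n : nat).
Implicit Types (x : n.-tuple T) (mu nu : probability (n.-tuple T) R)
  (Q : 'I_n -> probability T R).

Definition rectangle (B : 'I_n -> set T) : set (n.-tuple T) :=
  [set x | forall i, B i (tnth x i)].

Lemma measurable_rectangle B : (forall i, measurable (B i)) ->
  measurable (rectangle B).
Proof.
move=> mB.
rewrite (_ : rectangle B = \bigcap_(i in [set: 'I_n]) ((@tnth n T ^~ i) @^-1` B i)).
  apply: fin_bigcap_measurable => // i _.
  by rewrite -[X in measurable X]setTI; exact: measurable_tnth.
by apply/seteqP; split => [x Bx i _|x Bx i]; [exact: Bx|exact: (Bx i)].
Qed.

(** A product law is characterized by its values on rectangles instead of being constructed: laws of
    modified tuples are then identified by comparing their marginals. *)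
Definition product_law mu Q := forall B, (forall i, measurable (B i)) ->
  mu (rectangle B) = \prod_(i < n) Q i (B i).

(** The rectangles are stable under intersection and generate the sigma-algebra of the tuples. *)
Lemma product_law_unique mu nu Q : product_law mu Q -> product_law nu Q ->
  forall A, measurable A -> mu A = nu A.
Proof.
move=> muQ nuQ.
pose G := [set rectangle B | B in [set B | forall i, measurable (B i)]].
have GT : G setT.
  exists (fun=> setT); first by move=> i /=.
  by apply/seteqP; split => // x _ i.
apply: (@measure_unique _ _ _ G (fun=> setT)) => //.
- apply/seteqP; split; last first.
    apply: smallest_sub; first exact: sigma_algebra_measurable.
    by move=> _ [B mB <-]; exact: measurable_rectangle.
  apply: smallest_sub; first exact: smallest_sigma_algebra.
  rewrite -bigcup_seq => A [i _ [C mC <-]].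
  (* A generating cylinder is a rectangle with all sides but the [i]-th one full. *)
  apply: sub_sigma_algebra; exists (fun k => if k == i then C else setT).
    by move=> k /=; case: ifPn.
  rewrite setTI; apply/seteqP; split => x /=.
    by move=> /(_ i); rewrite eqxx.
  by move=> Cx k /=; case: eqP => // ->.
- move=> _ _ [B mB <-] [C mC <-]; exists (fun i => B i `&` C i).
    by move=> i /=; exact: measurableI.
  apply/seteqP; split => x /=; first by move=> BC; split=> i; case: (BC i).
  by move=> [Bx Cx] i; split.
- by rewrite bigcup_const//; exists 0%N.
- by move=> _ [B mB <-]; exact: etrans (muQ _ mB) (esym (nuQ _ mB)).
- by move=> _; apply: (le_lt_trans (probability_le1 mu measurableT)); exact: ltry.
Qed.

Lemma product_law_integral mu nu Q (h : n.-tuple T -> \bar R) :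
  product_law mu Q -> product_law nu Q -> \int[mu]_x h x = \int[nu]_x h x.
Proof.
move=> muQ nuQ; apply: eq_measure_integral => A mA _.
exact: product_law_unique muQ nuQ _ mA.
Qed.

Definition upd x (j : 'I_n) (t : T) : n.-tuple T :=
  [tuple if i == j then t else tnth x i | i < n].

Lemma tnth_upd x j t i : tnth (upd x j t) i = if i == j then t else tnth x i.
Proof. by rewrite tnth_mktuple. Qed.

Definition upd_pair j (z : n.-tuple T * T) := upd z.1 j z.2.

Lemma measurable_upd_pair j : measurable_fun setT (upd_pair j).
Proof.
apply/measurable_fun_tnthP => i.
under [X in measurable_fun _ X]eq_fun do rewrite /= tnth_upd.
case: (i == j); first exact: measurable_snd.
exact: measurableT_comp (measurable_tnth i) measurable_fst.
Qed.

Lemma measurable_upd1 x j : measurable_fun setT (upd x j).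
Proof.
apply/measurable_fun_tnthP => i.
under [X in measurable_fun _ X]eq_fun do rewrite /= tnth_upd.
by case: (i == j); [exact: measurable_id|exact: measurable_cst].
Qed.

HB.instance Definition _ j :=
  isMeasurableFun.Build _ _ _ _ (upd_pair j) (measurable_upd_pair j).

Definition resample mu j (P : probability T R) : probability (n.-tuple T) R :=
  distribution (mu \x P)%E (upd_pair j).

Definition upd_family Q j (P : probability T R) : 'I_n -> probability T R :=
  fun i => if i == j then P else Q i.

Lemma resample_integral mu j P (h : n.-tuple T -> \bar R) :
  measurable_fun setT h -> (forall x, 0 <= h x) ->
  \int[resample mu j P]_x h x = \int[mu]_x \int[P]_t h (upd x j t).
Proof.
move=> mh h0; rewrite ge0_integral_distribution// fubini_tonelli1//=.
exact: measurableT_comp.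
Qed.

Lemma resample_law mu Q j P : product_law mu Q ->
  product_law (resample mu j P) (upd_family Q j P).
Proof.
move=> muQ B mB.
(* The [j]-th side constrains only the fresh draw; the old tuple sees the rectangle with this side
   full. *)
pose B' i := if i == j then setT else B i.
have mB' i : measurable (B' i) by rewrite /B'; case: ifP.
rewrite [LHS](_ : _ = (mu \x P)%E (rectangle B' `*` B j)); last first.
  apply: (congr1 (mu \x P)%E).
  apply/seteqP; split => [[x t] /= Bxt|[x t] /= [Bx Bt] i].
    split.
      move=> i; rewrite /B'; case: ifPn => // ij.
      by move: (Bxt i); rewrite tnth_upd (negbTE ij).
    by move: (Bxt j); rewrite tnth_upd eqxx.
  rewrite tnth_upd; case: ifPn => [/eqP ->//|ij].
  by move: (Bx i); rewrite /B' (negbTE ij).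
rewrite product_measure1E//; last exact: measurable_rectangle.
transitivity (mu (rectangle B') * P (B j)); first by [].
rewrite muQ// (bigD1 j)//= [RHS](bigD1 j)//= /upd_family /B' !eqxx.
rewrite probability_setT mul1e muleC; congr (_ * _).
by apply: eq_bigr => i /negbTE ->.
Qed.

(** Resampling a coordinate from its own law does not change a product law. This serves as Fubini's
    theorem in the coordinate [j]. *)
Lemma product_law_resample mu Q j (h : n.-tuple T -> \bar R) :
  product_law mu Q -> measurable_fun setT h -> (forall x, 0 <= h x) ->
  \int[mu]_x h x = \int[mu]_x \int[Q j]_t h (upd x j t).
Proof.
move=> muQ mh h0; rewrite -resample_integral//.
apply: product_law_integral (muQ) _.
have := resample_law j (Q j) muQ.
suff -> : upd_family Q j (Q j) = Q by [].
by apply/funext => i; rewrite /upd_family; case: eqP => // ->.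
Qed.

Lemma measurable_tnth_comp d' (S : measurableType d') (f : T -> S) i :
  measurable_fun setT f ->
  measurable_fun setT (fun x : n.-tuple T => f (tnth x i)).
Proof. by move=> mf; exact: measurableT_comp mf (measurable_tnth i). Qed.

(** Integrating the coordinate [j] first, a change of its law costs a density factor in this
    coordinate alone. *)
Lemma resample_density mu Q j P L (h : n.-tuple T -> \bar R) :
  product_law mu Q -> has_density L P (Q j) ->
  measurable_fun setT h -> (forall x, 0 <= h x) ->
  \int[resample mu j P]_x h x = \int[mu]_x ((L (tnth x j))%:E * h x).
Proof.
move=> muQ LP mh h0; have [mL L0 _] := LP.
rewrite resample_integral// [RHS](product_law_resample j muQ); last 2 first.
- apply: emeasurable_funM => //.
  apply/measurable_EFinP; exact: measurable_tnth_comp.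
- by move=> x; rewrite mule_ge0// lee_fin.
apply: eq_integral => x _; rewrite (density_integral LP)//; last first.
  exact: measurableT_comp mh (measurable_upd1 x j).
by apply: eq_integral => t _; rewrite tnth_upd eqxx muleC.
Qed.

Lemma measurable_permute (s : 'S_n) : measurable_fun setT (@permute n T s).
Proof.
apply/measurable_fun_tnthP => i.
under [X in measurable_fun _ X]eq_fun do rewrite /= /permute tnth_mktuple.
exact: measurable_tnth.
Qed.

HB.instance Definition _ s :=
  isMeasurableFun.Build _ _ _ _ (@permute n T s) (measurable_permute s).

(** The preimage of a rectangle is the rectangle whose sides are permuted by the inverse of [s]. *)
Lemma permute_law mu Q (s : 'S_n) : product_law mu Q ->
  product_law (distribution mu (@permute n T s)) (Q \o s).
Proof.
move=> muQ B mB; rewrite /distribution /pushforward.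
transitivity (mu (rectangle (B \o (s^-1)%g))).
  apply: (congr1 mu); apply/seteqP; split => [x Bx i|x Bx i] /=.
    by have := Bx ((s^-1)%g i); rewrite /permute tnth_mktuple permKV.
  by rewrite /permute tnth_mktuple; have := Bx (s i); rewrite /= permK.
rewrite muQ; last by move=> i /=.
rewrite [RHS](reindex_inj (@perm_inj _ (s^-1)%g))/=.
by apply: eq_bigr => i _; rewrite permKV.
Qed.

Lemma permute_integral mu nu Q (s : 'S_n) (h : n.-tuple T -> \bar R) :
  product_law mu Q -> product_law nu (Q \o s) ->
  measurable_fun setT h -> (forall x, 0 <= h x) ->
  \int[mu]_x h (permute s x) = \int[nu]_x h x.
Proof.
move=> muQ nuQ mh h0.
rewrite -(product_law_integral h (permute_law s muQ) nuQ).
by rewrite ge0_integral_distribution.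
Qed.

End tuple_laws.

(** * Complements on integrals and measurability *)

Section integral_complements.
Context (d : measure_display) (T : measurableType d) (R : realType).
Implicit Types (mu : {measure set T -> \bar R}).

(* Unlike [ge0_le_integral], no measurability is required. *)
Lemma ge0_le_integralT mu (f g : T -> \bar R) : (forall t, 0 <= f t) ->
  (forall t, f t <= g t) -> \int[mu]_t f t <= \int[mu]_t g t.
Proof.
move=> f0 fg; have g0 t : 0 <= g t by exact: le_trans (f0 t) (fg t).
rewrite !ge0_integralTE//; apply: le_ereal_sup => _ [h hf <-].
by exists h => // x; exact: le_trans (hf x) (fg x).
Qed.

Lemma integral_lty_null_set mu (f : T -> \bar R) N : measurable N ->
  (forall t, 0 <= f t) -> (forall t, N t -> f t = +oo) ->
  \int[mu]_t f t < +oo -> mu N = 0.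
Proof.
move=> mN f0 fN; rewrite ltNge; apply: contraNeq => N0.
have <- : \int[mu]_(t in N) cst +oo t = +oo.
  by rewrite integral_cst// gt0_mulye// lt0e N0 measure_ge0.
rewrite integral_mkcond; apply: ge0_le_integralT => t; rewrite patchE.
  by case: ifP => _; [exact: le0y|exact: lexx].
case: ifPn => [/set_mem/fN ->|_]; [exact: lexx|exact: f0].
Qed.

(** On nonnegative reals the inverse is the power -1, also at 0, where both are 0 by convention. *)
Lemma measurable_funV (f : T -> R) : measurable_fun setT f ->
  (forall t, (0 <= f t)%R) -> measurable_fun setT (fun t => (f t)^-1%R).
Proof.
move=> mf f0.
under eq_fun do rewrite -powR_inv1//.
exact: measurableT_comp (measurable_powR _) mf.
Qed.

Lemma measurable_fun_div (f g : T -> R) : measurable_fun setT f ->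
  measurable_fun setT g -> (forall t, (0 <= g t)%R) ->
  measurable_fun setT (fun t => f t / g t)%R.
Proof. by move=> mf mg g0; apply: measurable_funM => //; exact: measurable_funV. Qed.

Lemma probability_integral_cst (P : probability T R) (c : \bar R) :
  \int[P]_t c = c.
Proof. by rewrite -[RHS]mule1 -(probability_setT P) -integral_cst. Qed.

End integral_complements.

(** * Second moments of densities, chi-square divergence and its variational lower bound *)

Section density_moments.
Context (d : measure_display) (T : measurableType d) (R : realType).
Implicit Types (P Q : probability T R) (L : T -> R).

Lemma density_integral1 L P (mu : {finite_measure set T -> \bar R}) :
  has_density L P mu -> \int[mu]_t (L t)%:E = 1.
Proof. by move=> [_ _ PL]; rewrite -PL// probability_setT. Qed.

(** This is [int L^2 = 1 + int (L - 1)^2], arranged so that nothing possibly infinite is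
    subtracted. *)
Lemma density_sqr L P Q : has_density L P Q ->
  \int[Q]_t ((L t) ^+ 2)%:E + 1 = \int[Q]_t ((L t - 1) ^+ 2)%:E + 2.
Proof.
move=> LP; have [mL L0 _] := LP.
have mL2 : measurable_fun setT (fun t => ((L t) ^+ 2)%:E).
  by apply/measurable_EFinP; exact: measurable_funX.
have mLB : measurable_fun setT (fun t => ((L t - 1) ^+ 2)%:E).
  by apply/measurable_EFinP; apply: measurable_funX; exact: measurable_funB.
have m2L : measurable_fun setT (fun t => (2 * L t)%:E).
  by apply/measurable_EFinP; exact: measurable_funM.
transitivity (\int[Q]_t (((L t) ^+ 2)%:E + 1)).
  rewrite ge0_integralD//.
    by rewrite probability_integral_cst.
  by move=> t _; rewrite lee_fin sqr_ge0.
transitivity (\int[Q]_t (((L t - 1) ^+ 2)%:E + (2 * L t)%:E)).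
  by apply: eq_integral => t _; rewrite -!EFinD; congr EFin; ring.
rewrite ge0_integralD//; last 2 first.
- by move=> t _; rewrite lee_fin sqr_ge0.
- by move=> t _; rewrite lee_fin mulr_ge0.
under [X in _ + X]eq_integral do rewrite EFinM.
rewrite ge0_integralZl_EFin//; last 2 first.
- by move=> t _; rewrite lee_fin.
- exact/measurable_EFinP.
by rewrite (density_integral1 LP) mule1.
Qed.

End density_moments.

Section chi2_divergence.
Context (d : measure_display) (T : measurableType d) (R : realType).
Implicit Types (P Q S : probability T R) (g : T -> R).

Definition rdensity P Q S : T -> R := fine \o density P Q S.

Lemma rdensityP P Q S : S `<< dominating P Q ->
  has_density (rdensity P Q S) S (dominating P Q) /\
  forall t, density P Q S t = (rdensity P Q S t)%:E.
Proof.
move=> SD; have E t : density P Q S t = (rdensity P Q S t)%:E.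
  by rewrite fineK//; exact: Radon_Nikodym_SigmaFinite.f_fin_num.
split=> //; split.
- have := measurable_int _ (Radon_Nikodym_SigmaFinite.f_integrable SD).
  exact: measurableT_comp.
- by move=> t; rewrite -lee_fin -E; exact: Radon_Nikodym_SigmaFinite.f_ge0.
- move=> A mA; rewrite (Radon_Nikodym_SigmaFinite.f_integral SD mA).
  by apply: eq_integral => t _; rewrite -E.
Qed.

Lemma dominating_l P Q : P `<< dominating P Q.
Proof.
apply/null_content_dominatesP => A mA /=.
rewrite /dominating measure_addE => /eqP.
by rewrite padde_eq0// => /andP[/eqP].
Qed.

Lemma dominating_r P Q : Q `<< dominating P Q.
Proof.
apply/null_content_dominatesP => A mA /=.
rewrite /dominating measure_addE => /eqP.
by rewrite padde_eq0// => /andP[_ /eqP].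
Qed.

Let p P Q := rdensity P Q P.
Let q P Q := rdensity P Q Q.

(** Where both densities vanish, the real quotient has the default value 0, in agreement with the
    extended one; the value [+oo] is isolated in its own branch. *)
Lemma chi2_integrandE P Q t :
  (density P Q P t - density P Q Q t) ^+ 2 / density P Q Q t =
  if (q P Q t == 0)%R && (p P Q t != 0)%R then +oo
  else ((p P Q t - q P Q t) ^+ 2 / q P Q t)%:E.
Proof.
rewrite (rdensityP (@dominating_l P Q)).2 (rdensityP (@dominating_r P Q)).2.
rewrite -/(p P Q t) -/(q P Q t) expe2 inver; case: eqP => [->|q0]; last first.
  by rewrite -EFinD -!EFinM expr2.
rewrite sube0 -EFinM; case: eqP => [->|/eqP p0] /=.
  by rewrite mulr0 mul0e invr0 mulr0.
by rewrite gt0_muley// lte_fin -expr2 exprn_even_gt0.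
Qed.

Lemma chi2_integrand_ge0 P Q t :
  0 <= (density P Q P t - density P Q Q t) ^+ 2 / density P Q Q t.
Proof.
have [[_ q0 _] _] := rdensityP (@dominating_r P Q).
rewrite chi2_integrandE; case: ifP => _; first exact: le0y.
by rewrite lee_fin divr_ge0 ?sqr_ge0//; exact: q0.
Qed.

Lemma chi2_ge0 P Q : 0 <= chi2 P Q.
Proof. by apply: integral_ge0 => t _; exact: chi2_integrand_ge0. Qed.

(** The density is the quotient [u / v] of the densities with respect to [dominating P Q]:
    finiteness of the divergence makes the set [N], where only [v] vanishes, negligible. *)
Lemma chi2_density P Q : chi2 P Q < +oo -> exists2 L, has_density L P Q &
  \int[Q]_t ((L t - 1) ^+ 2)%:E <= chi2 P Q.
Proof.
move=> chifin.
have [Hp _] := rdensityP (@dominating_l P Q).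
have [Hq _] := rdensityP (@dominating_r P Q).
have [mp p0 pP] := Hp; have [mq q0 qQ] := Hq.
rewrite -/(p P Q) in Hp mp p0 pP; rewrite -/(q P Q) in Hq mq q0 qQ.
set u := p P Q in Hp mp p0 pP; set v := q P Q in Hq mq q0 qQ.
pose N := [set t | v t = 0%R] `&` [set t | u t != 0%R].
have mN : measurable N.
  apply: measurableI.
    by rewrite -[X in measurable X]setTI; apply: (mq measurableT [set 0%R]).
  rewrite (_ : [set t | _] = ~` (u @^-1` [set 0%R])); last first.
    by apply/seteqP; split => t /= /eqP.
  by apply: measurableC; rewrite -[X in measurable X]setTI; apply: (mp measurableT [set 0%R]).
have N0 : dominating P Q N = 0.
  apply: (integral_lty_null_set mN _ _ chifin) => t.
    exact: chi2_integrand_ge0.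
  by move=> [/= vt ut]; rewrite chi2_integrandE -/u -/v vt eqxx ut.
have mL : measurable_fun setT (fun t => u t / v t)%R.
  exact: measurable_fun_div.
have mR (f : T -> R) A : measurable A -> measurable_fun setT f ->
    measurable_fun setT ((fun t => (f t)%:E) \_ A).
  by move=> mA mf; apply/(measurable_restrictT _ mA)/measurable_funTS/measurable_EFinP.
have L0 t : (0 <= u t / v t)%R by rewrite divr_ge0.
exists (fun t => u t / v t)%R; first split => //.
  move=> A mA; rewrite integral_mkcond (density_integral Hq)//; last 2 first.
  - exact: mR.
  - by move=> t; rewrite patchE; case: ifP => // _; rewrite lee_fin.
  rewrite pP// integral_mkcond; apply: ge0_ae_eq_integral => //.
  - exact: mR.
  - apply: emeasurable_funM; last exact/measurable_EFinP.
    exact: mR.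
  - by move=> t _; rewrite patchE; case: ifP => // _; rewrite lee_fin.
  - move=> t _; rewrite mule_ge0 ?lee_fin//.
    by rewrite patchE; case: ifP => // _; rewrite lee_fin.
  (* Outside [N], [u / v * v = u] also holds where [v] is 0, since [u] is 0 there too. *)
  exists N; split => // t /= /not_implyP[_]; rewrite !patchE.
  case: ifPn => [_|_]; last by rewrite mul0e.
  rewrite -EFinM /N /= => H; have [vt|vt] := eqVneq (v t) 0%R.
    by split=> //; apply/eqP => ut; apply: H; rewrite ut vt !mul0r.
  by exfalso; apply: H; rewrite divfK.
rewrite (density_integral Hq); last 2 first.
- by apply/measurable_EFinP; apply: measurable_funX; exact: measurable_funB.
- by move=> t; rewrite lee_fin sqr_ge0.
apply: ge0_le_integralT => t; first by rewrite mule_ge0// lee_fin// sqr_ge0.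
rewrite chi2_integrandE -/u -/v; case: ifPn => [_|]; first exact: leey.
rewrite -EFinM lee_fin; have [vt|vt _] := eqVneq (v t) 0%R.
  by rewrite vt mulr0 invr0 mulr0.
by rewrite le_eqVlt; apply/orP; left; apply/eqP; field.
Qed.

(** With [L] the density of [P], integrate [2 g L <= L^2 + g^2] and use [int L^2 = 1 + chi2]. An
    infinite divergence makes the bound trivial. *)
Lemma chi2_ge_variational P Q g : measurable_fun setT g ->
  (forall t, (0 <= g t)%R) ->
  2 * \int[P]_t (g t)%:E <= 1 + chi2 P Q + \int[Q]_t ((g t) ^+ 2)%:E.
Proof.
move=> mg g0.
have mEg : measurable_fun setT (EFin \o g) by exact/measurable_EFinP.
have mg2 : measurable_fun setT (fun t => ((g t) ^+ 2)%:E).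
  by apply/measurable_EFinP; exact: measurable_funX.
have [chioo|] := eqVneq (chi2 P Q) +oo.
  rewrite chioo addey// addye ?leey// -ltNye (lt_le_trans (ltNyr 0))//.
  by apply: integral_ge0 => t _; rewrite lee_fin sqr_ge0.
rewrite -ltey => /chi2_density[L LP Lchi]; have [mL L0 _] := LP.
have mL2 : measurable_fun setT (fun t => ((L t) ^+ 2)%:E).
  by apply/measurable_EFinP; exact: measurable_funX.
apply: (@le_trans _ _ (\int[Q]_t (((L t) ^+ 2)%:E + ((g t) ^+ 2)%:E))).
  rewrite (density_integral LP)//.
  rewrite -ge0_integralZl_EFin//; last 2 first.
  - by move=> t _; rewrite mule_ge0// lee_fin.
  - by apply: emeasurable_funM => //; exact/measurable_EFinP.
  apply: ge0_le_integralT => t; first by rewrite !mule_ge0// lee_fin.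
  rewrite -!EFinM lee_fin -subr_ge0.
  by rewrite [leRHS](_ : _ = (L t - g t) ^+ 2)%R ?sqr_ge0//; ring.
rewrite ge0_integralD//; last 2 first.
- by move=> t _; rewrite lee_fin sqr_ge0.
- by move=> t _; rewrite lee_fin sqr_ge0.
rewrite leeD2r// -(@leeD2rE _ 1)//. rewrite (density_sqr LP).
rewrite [1 + _]addeC -(addeA (chi2 P Q)) -EFinD.
exact: leeD2r.
Qed.

End chi2_divergence.

(* With [r := a / b], this is [s * r ^ 2 <= r + s ^ 3 * r ^ 4], which holds since
   [r ^ 2 <= r / s] if [r <= 1 / s] and [r ^ 2 <= s ^ 2 * r ^ 4] otherwise. *)
Lemma hellinger_chi2_pointwise (R : realFieldType) (a b s : R) :
  (0 <= a)%R -> (0 < b)%R -> (0 < s)%R ->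
  ((a - b) ^+ 2 + 2 * s * a ^+ 2 + 2 * s ^+ 3 * b ^+ 2 <=
   a ^+ 2 + b ^+ 2 +
   2 * s ^+ 3 * ((a ^+ 2 - b ^+ 2) ^+ 2 / b ^+ 2 + 2 * a ^+ 2))%R.
Proof.
move=> a0 b0 s0; have bn : b != 0%R by rewrite gt_eqF.
have /ltW b0' := b0; have /ltW s0' := s0.
rewrite -subr_ge0.
rewrite [leRHS](_ : _ = 2 * (a * b ^+ 3 + s ^+ 3 * a ^+ 4 -
  s * a ^+ 2 * b ^+ 2) / b ^+ 2)%R; last by field.
apply: divr_ge0; last exact: sqr_ge0.
apply: mulr_ge0 => //; rewrite subr_ge0.
have [sab|/ltW bsa] := leP (s * a)%R b.
  apply: (@le_trans _ _ (a * b ^+ 3)%R).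
    rewrite -subr_ge0 [leRHS](_ : _ = a * b ^+ 2 * (b - s * a))%R; last by ring.
    by rewrite !mulr_ge0// ?sqr_ge0// subr_ge0.
  by rewrite lerDl mulr_ge0// exprn_ge0.
apply: (@le_trans _ _ (s ^+ 3 * a ^+ 4)%R).
  rewrite -subr_ge0.
  rewrite [leRHS](_ : _ = s * a ^+ 2 * ((s * a - b) * (s * a + b)))%R; last by ring.
  apply: mulr_ge0; first by rewrite mulr_ge0 ?sqr_ge0.
  by rewrite mulr_ge0 ?subr_ge0// addr_ge0// mulr_ge0.
by rewrite lerDr mulr_ge0// exprn_ge0.
Qed.

(** * Variational upper bound for the chi-square divergence; Hellinger distance bounded away from
    2 *)

Section chi2_bounds.
Context (d : measure_display) (T : measurableType d) (R : realType).
Implicit Types (P Q : probability T R) (g : T -> R).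

(** The test functions are the likelihood ratios truncated at [N], which increase to the ratio
    itself. The constant is not sharp ([B - 1] would be), but the lemma serves only to prove
    finiteness. *)
Lemma chi2_le_variational P Q (B : R) :
  (forall g K, measurable_fun setT g -> (forall t, (0 <= g t <= K)%R) ->
    2 * \int[P]_t (g t)%:E <= B%:E + \int[Q]_t ((g t) ^+ 2)%:E) ->
  chi2 P Q <= (B + 1)%:E.
Proof.
move=> hB.
have [Hp _] := rdensityP (@dominating_l _ _ _ P Q).
have [Hq _] := rdensityP (@dominating_r _ _ _ P Q).
set u := rdensity P Q P in Hp; set v := rdensity P Q Q in Hq.
have [mu u0 uP] := Hp; have [mv v0 vQ] := Hq.
(* This is the minimum of [u / v] and [N], with value [N] where only [v] vanishes and 0 where both
   do. *)
pose g (N : nat) t := (if u t <= N%:R * v t then u t / v t else N%:R)%R.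
have mg N : measurable_fun setT (g N).
  apply: measurable_fun_ifT.
  - by apply: measurable_fun_ler => //; exact: measurable_funM.
  - exact: measurable_fun_div.
  - exact: measurable_cst.
have g0 N t : (0 <= g N t)%R by rewrite /g; case: ifP => // _; rewrite divr_ge0.
have gN N t : (g N t <= N%:R)%R.
  rewrite /g; case: ifPn => // uv; have [vt|vt] := eqVneq (v t) 0%R.
    by rewrite vt invr0 mulr0.
  by rewrite ler_pdivrMr// lt0r vt v0.
have gv N t : (g N t * v t <= u t)%R.
  rewrite /g; case: ifPn => uv; last by rewrite ltW// ltNge.
  have [->|vt] := eqVneq (v t) 0%R; first by rewrite mulr0.
  by rewrite divfK.
have gnd N N' t : (N <= N')%N -> (g N t <= g N' t)%R.
  move=> NN'; rewrite {2}/g; case: ifPn => uv'; last first.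
    by rewrite (le_trans (gN _ _))// ler_nat.
  rewrite /g; case: ifPn => // uv.
  have vt : (0 < v t)%R.
    rewrite lt0r v0 andbT; apply: contra uv => /eqP vt.
    by move: uv'; rewrite vt !mulr0.
  by rewrite ler_pdivlMr// ltW// ltNge.
pose f N t := (g N t * u t)%:E.
have mf N : measurable_fun setT (f N).
  by apply/measurable_EFinP; exact: measurable_funM.
have f0 N t : 0 <= f N t by rewrite lee_fin mulr_ge0.
have fnd t : {homo f^~ t : N N' / (N <= N')%N >-> N <= N'}.
  by move=> N N' NN'; rewrite lee_fin ler_wpM2r// gnd.
have limf t : limn (f^~ t) = ereal_sup (range (f^~ t)).
  by apply/cvg_lim => //; exact: ereal_nondecreasing_cvgn.
have intf N : \int[dominating P Q]_t f N t = \int[P]_t (g N t)%:E.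
  rewrite (density_integral Hp)//; first exact/measurable_EFinP.
  by move=> t; rewrite lee_fin.
have fB N : \int[dominating P Q]_t f N t <= B%:E.
  rewrite intf; have gK t : (0 <= g N t <= N%:R)%R by rewrite g0 gN.
  have := hB _ _ (mg N) gK.
  (* Since [g v <= u], the quadratic term absorbs one of the two copies of the linear one, which
     leaves the bound [B]. *)
  have g2 : \int[Q]_t ((g N t) ^+ 2)%:E <= \int[P]_t (g N t)%:E.
    rewrite -intf (density_integral Hq); last 2 first.
    - by apply/measurable_EFinP; exact: measurable_funX.
    - by move=> t; rewrite lee_fin sqr_ge0.
    apply: ge0_le_integralT => t; first by rewrite mule_ge0// lee_fin// sqr_ge0.
    by rewrite -EFinM lee_fin expr2 -mulrA ler_wpM2l.
  have gfin : \int[P]_t (g N t)%:E \is a fin_num.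
    rewrite ge0_fin_numE; last by apply: integral_ge0 => t _; rewrite lee_fin.
    apply: (@le_lt_trans _ _ (\int[P]_t N%:R%:E)); last first.
      by rewrite probability_integral_cst ltry.
    by apply: ge0_le_integralT => t; rewrite lee_fin.
  move=> /le_trans/(_ (leeD2l _ g2)).
  move: gfin; case: (\int[P]_t (g N t)%:E) => // r _.
  by rewrite -EFinM -EFinD !lee_fin; lra.
have mEv : measurable_fun setT (EFin \o v) by exact/measurable_EFinP.
have mlim : measurable_fun setT (fun t => limn (f^~ t)).
  apply: (emeasurable_fun_cvg f) => // t _.
  by apply: ereal_nondecreasing_is_cvgn; exact: fnd.
have lim0 t : 0 <= limn (f^~ t).
  by rewrite limf; apply: (le_trans (f0 0%N t)); apply: ereal_sup_ubound; exists 0%N.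
apply: (@le_trans _ _ (\int[dominating P Q]_t (limn (f^~ t) + (v t)%:E))).
  apply: ge0_le_integralT => t; first exact: chi2_integrand_ge0.
  rewrite chi2_integrandE -/u -/v limf; case: ifPn => [/andP[/eqP vt ut]|].
    rewrite [X in X + _](_ : _ = +oo) ?addye//.
    (* Where [v] is 0 and [u] is not, [f N t = N * u t] is unbounded in [N]. *)
    apply/eq_infty => r; pose N := (Num.truncn (`|r| / u t)).+1.
    have uN : (`|r| / u t < N%:R)%R by rewrite /N truncnS_gt.
    apply: (@le_trans _ _ (f N t)); last by apply: ereal_sup_ubound; exists N.
    have upos : (0 < u t)%R by rewrite lt0r ut u0.
    rewrite lee_fin /g vt mulr0 (leNgt (u t)) upos/=.
    by rewrite (le_trans (ler_norm _))// -ler_pdivrMr// ltW.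
  have [vt|vt _] := eqVneq (v t) 0%R.
    by rewrite /= negbK => /eqP ->; rewrite vt subrr expr2 !mul0r adde0 -limf.
  have vpos : (0 < v t)%R by rewrite lt0r vt v0.
  (* For this [N] the truncation is inactive, and [(u - v)^2 / v <= u^2 / v + v]. *)
  pose N := (Num.truncn (u t / v t)).+1.
  have uN : (u t / v t < N%:R)%R by rewrite /N truncnS_gt.
  apply: (@le_trans _ _ (f N t + (v t)%:E)); last first.
    by apply: leeD2r; apply: ereal_sup_ubound; exists N.
  rewrite -EFinD lee_fin /g.
  have -> : (u t <= N%:R * v t)%R by rewrite -ler_pdivrMr// ltW.
  rewrite -subr_ge0 [leRHS](_ : _ = 2 * u t)%R; first by rewrite mulr_ge0.
  by field.
rewrite ge0_integralD//; last by move=> t _; rewrite lee_fin.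
rewrite (density_integral1 Hq) EFinD leeD2r//.
rewrite monotone_convergence//.
apply: lime_le; last exact: nearW.
apply: ereal_nondecreasing_is_cvgn => N N' NN'.
by apply: ge0_le_integralT => // t; exact: fnd.
Qed.

(** Integrating [hellinger_chi2_pointwise] at the square roots of the densities gives
    [H^2 <= 2 - 2 s + 2 s^3 (chi2 + 1)], whose last term is at most [s] by the choice of [s]. *)
Lemma hellinger2_le P Q (D s : R) : chi2 P Q <= D%:E -> (0 < s)%R ->
  (s ^+ 2 * (D + 1) <= 2^-1)%R -> hellinger2 P Q <= (2 - s)%:E.
Proof.
move=> chiD s0 sD.
have [Hp pE] := rdensityP (@dominating_l _ _ _ P Q).
have [Hq qE] := rdensityP (@dominating_r _ _ _ P Q).
set u := rdensity P Q P in Hp pE; set v := rdensity P Q Q in Hq qE.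
have [mu u0 uP] := Hp; have [mv v0 vQ] := Hq.
have mEu : measurable_fun setT (EFin \o u) by exact/measurable_EFinP.
have mEv : measurable_fun setT (EFin \o v) by exact/measurable_EFinP.
pose w t := ((Num.sqrt (u t) - Num.sqrt (v t)) ^+ 2)%:E.
pose phi t := (density P Q P t - density P Q Q t) ^+ 2 / density P Q Q t.
have phi0 t : 0 <= phi t by exact: chi2_integrand_ge0.
have msqrt (h : T -> R) : measurable_fun setT h ->
    measurable_fun setT (fun t => Num.sqrt (h t)).
  by apply: measurableT_comp; apply: continuous_measurable_fun; exact: sqrt_continuous.
have mw : measurable_fun setT w.
  by apply/measurable_EFinP; apply: measurable_funX; apply: measurable_funB; exact: msqrt.
have mphi : measurable_fun setT phi.
  rewrite [phi](_ : _ = fun t => if (v t == 0)%R && (u t != 0)%R then +oo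
    else ((u t - v t) ^+ 2 / v t)%:E); last first.
    by apply/funext => t; exact: chi2_integrandE.
  apply: measurable_fun_ifT => //.
    apply: measurable_and; first exact: measurable_fun_eqr.
    by apply: measurable_neg; exact: measurable_fun_eqr.
  apply/measurable_EFinP; apply: measurable_fun_div => //.
  by apply: measurable_funX; exact: measurable_funB.
have c1 : (0 <= 2 * s)%R by lra.
have s30 : (0 <= s ^+ 3)%R by rewrite exprn_ge0// ltW.
have c3 : (0 <= 2 * s ^+ 3)%R by lra.
have -> : hellinger2 P Q = \int[dominating P Q]_t w t.
  by apply: eq_integral => t _; rewrite pE qE -/u -/v expe2 -EFinD -EFinM -expr2.
have key t : w t + (2 * s)%:E * (u t)%:E + (2 * s ^+ 3)%:E * (v t)%:E <=
    (u t)%:E + (v t)%:E + (2 * s ^+ 3)%:E * (phi t + 2 * (u t)%:E).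
  rewrite /phi chi2_integrandE -/u -/v; case: ifPn => [_|].
    rewrite addye; last by [].
    by rewrite gt0_muley ?addey ?leey// lte_fin mulr_gt0// exprn_gt0.
  rewrite -!EFinM -!EFinD lee_fin.
  pose a : R := Num.sqrt (u t); pose b : R := Num.sqrt (v t).
  have a0 : (0 <= a)%R by exact: sqrtr_ge0.
  have b0 : (0 <= b)%R by exact: sqrtr_ge0.
  have -> : u t = (a ^+ 2)%R by rewrite sqr_sqrtr.
  have -> : v t = (b ^+ 2)%R by rewrite sqr_sqrtr.
  rewrite !sqrtr_sqr !ger0_norm// !expf_eq0/=.
  have [->|bn] := eqVneq b 0%R.
    by rewrite /= negbK => /eqP ->; rewrite !expr0n/= !(subr0,mulr0,mul0r,addr0,invr0) expr0n.
  move=> _; have bp : (0 < b)%R by rewrite lt0r bn b0.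
  exact: hellinger_chi2_pointwise.
have w0 t : 0 <= w t by rewrite lee_fin sqr_ge0.
have cu0 t : 0 <= (2 * s)%:E * (u t)%:E by rewrite mule_ge0// lee_fin.
have cv0 t : 0 <= (2 * s ^+ 3)%:E * (v t)%:E by rewrite mule_ge0// lee_fin.
have mcu : measurable_fun setT (fun t => (2 * s)%:E * (u t)%:E).
  by apply: emeasurable_funM.
have mcv : measurable_fun setT (fun t => (2 * s ^+ 3)%:E * (v t)%:E).
  by apply: emeasurable_funM.
have m2u : measurable_fun setT (fun t => 2 * (u t)%:E).
  by apply: emeasurable_funM.
have wcu0 t : 0 <= w t + (2 * s)%:E * (u t)%:E by exact: adde_ge0.
have mwcu : measurable_fun setT (fun t => w t + (2 * s)%:E * (u t)%:E).
  exact: emeasurable_funD.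
have u0' t : 0 <= (u t)%:E by rewrite lee_fin.
have v0' t : 0 <= (v t)%:E by rewrite lee_fin.
have u20 t : 0 <= 2 * (u t)%:E by exact: mule_ge0.
have pu0 t : 0 <= phi t + 2 * (u t)%:E by exact: adde_ge0.
have mpu : measurable_fun setT (fun t => phi t + 2 * (u t)%:E).
  exact: emeasurable_funD.
have cpu0 t : 0 <= (2 * s ^+ 3)%:E * (phi t + 2 * (u t)%:E).
  by rewrite mule_ge0// lee_fin.
have mcpu : measurable_fun setT (fun t => (2 * s ^+ 3)%:E * (phi t + 2 * (u t)%:E)).
  exact: emeasurable_funM.
have uv0 t : 0 <= (u t)%:E + (v t)%:E by exact: adde_ge0.
have muv : measurable_fun setT (fun t => (u t)%:E + (v t)%:E).
  exact: emeasurable_funD.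
have := @ge0_le_integralT _ _ _ (dominating P Q) _ _
  (fun t => adde_ge0 (wcu0 t) (cv0 t)) key.
rewrite !ge0_integralD// !ge0_integralZl_EFin// ge0_integralD//.
rewrite ge0_integralZl_EFin//.
rewrite (density_integral1 Hp) (density_integral1 Hq) -/(chi2 P Q).
have : chi2 P Q \is a fin_num.
  by rewrite ge0_fin_numE ?chi2_ge0// (le_lt_trans chiD)// ltry.
move: chiD; case: (chi2 P Q) => // c cD _.
have : 0 <= \int[dominating P Q]_t w t by apply: integral_ge0.
case: (\int[dominating P Q]_t w t) => [h _| |]//.
rewrite -!EFinM -!EFinD !lee_fin => H.
have {}cD : (c <= D)%R by rewrite -lee_fin.
have : (2 * s ^+ 3 * (c + 1) <= s)%R.
  rewrite -subr_ge0 [leRHS](_ : _ = 2 * s * (2^-1 - s ^+ 2 * (c + 1)))%R; last by field.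
  rewrite mulr_ge0// subr_ge0 (le_trans _ sD)// ler_wpM2l ?sqr_ge0//; lra.
by lra.
Qed.

End chi2_bounds.

(** * Mixtures over priors; finiteness of the capacity and of [hellinger_Delta] *)

Section mixtures.
Context (d : measure_display) (T : measurableType d) (R : realType).
Implicit Types (rho : probability (pprobability T R) R) (f : T -> \bar R).

Lemma measurable_integral_pprobability f :
  measurable_fun setT f -> (forall t, 0 <= f t) ->
  measurable_fun [set: pprobability T R]
    (fun P : probability T R => \int[P]_t f t).
Proof.
move=> mf f0; apply: measurable_fun_integral_kernel => // U mU.
exact: measurable_eval.
Qed.

(** The mixture is the composition of the constant kernel [rho] on [unit] with the kernel that sends
    a probability measure to itself. *)
Lemma mixture_integral rho f : measurable_fun setT f -> (forall t, 0 <= f t) ->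
  \int[mixture rho]_t f t = \int[rho]_P \int[(P : probability T R)]_t f t.
Proof.
move=> mf f0.
have mc : measurable_fun [set: unit] (fun=> rho : pprobability _ R).
  exact: measurable_cst.
have ms : measurable_fun [set: unit * pprobability T R]
    (fun z : unit * pprobability T R => z.2).
  exact: measurable_snd.
exact: (integral_kcomp (kprobability mc) (kprobability ms) tt f0 mf).
Qed.

End mixtures.

Section capacity.
Context (d : measure_display) (T : measurableType d) (R : realType).
Implicit Types (F : set (probability T R)) (P : probability T R).

Lemma chi2_le_diameter F P Q : F P -> F Q -> chi2 P Q <= chi2_diameter F.
Proof. by move=> FP FQ; apply: ereal_sup_ubound; exists P => //; exists Q. Qed.

Import HBNNSimple.

(** Neither [F] nor [f] need be measurable. For a simple function [h] below [f], however, the set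
    where [h <= c] is measurable and contains [F], so [rho] gives it mass 1. *)
Lemma prior_on_integral_le F (rho : probability (pprobability T R) R)
    (f : pprobability T R -> \bar R) (c : R) : prior_on F rho ->
  (forall P, 0 <= f P) -> (forall P, F P -> f P <= c%:E) ->
  \int[rho]_P f P <= c%:E.
Proof.
move=> Frho f0 fc; have [[P0 FP0]|F0] := pselect (exists P, F P); last first.
  have : rho set0 = 1 by apply: Frho => // P FP; case: F0; exists P.
  by move=> /eqP; rewrite measure0 eq_sym onee_eq0.
have c0 : (0 <= c)%R.
  by rewrite -lee_fin (le_trans (f0 P0))// fc.
rewrite ge0_integralTE//; apply: ge_ereal_sup => _ [h hf <-].
rewrite -integralT_nnsfun -[leRHS](probability_integral_cst rho).
pose E := [set P | (h P)%:E <= c%:E].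
have mh : measurable_fun setT (h : pprobability T R -> R) by exact: measurable_funPT.
have mE : measurable E.
  by rewrite -[E]setTI; apply: emeasurable_fun_infty_c => //; exact/measurable_EFinP.
have rE : rho E = 1.
  by apply: Frho => // P FP; rewrite /E /= (le_trans (hf P))// fc.
have rE' : rho (~` E) = 0 by rewrite probability_setC// rE subee.
apply: ae_ge0_le_integral => //.
- by move=> P _; rewrite lee_fin.
- exact/measurable_EFinP.
- exists (~` E); split; [exact: measurableC|exact: rE'|].
  by move=> P /=; apply: contra_not => Ph _.
Qed.

(* The variational formula makes [chi2] convex in its second argument, up to the
   additive constant lost by [chi2_le_variational]. *)
Lemma chi2_mixture_le F (rho : probability (pprobability T R) R) P (D : R) :
  prior_on F rho -> F P -> chi2_diameter F <= D%:E ->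
  chi2 P (mixture rho) <= (D + 2)%:E.
Proof.
move=> Frho FP FD; rewrite (_ : D + 2 = 1 + D + 1)%R; last by ring.
apply: chi2_le_variational => g K mg gK.
have g0 t : (0 <= g t)%R by case/andP: (gK t).
have D0 : (0 <= D)%R.
  by rewrite -lee_fin (le_trans _ FD)// (le_trans _ (chi2_le_diameter FP FP))// chi2_ge0.
have mg2 : measurable_fun setT (fun t => (g t ^+ 2)%:E).
  by apply/measurable_EFinP; exact: measurable_funX.
have g20 t : 0 <= (g t ^+ 2)%:E by rewrite lee_fin sqr_ge0.
rewrite mixture_integral// -[(1 + D)%:E](probability_integral_cst rho).
have mI := measurable_integral_pprobability mg2 g20.
have I0 (S : probability T R) : 0 <= \int[S]_t (g t ^+ 2)%:E by exact: integral_ge0.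
rewrite -ge0_integralD//; last by move=> S _; rewrite lee_fin addr_ge0.
set a := 2 * _.
have a0 : 0 <= a by rewrite mule_ge0// integral_ge0// => t _; rewrite lee_fin.
(* The variational inequality holds for each [S] in [F]; as [E] is measurable, it holds [rho]-almost
   everywhere and can be integrated. *)
pose E := [set S : pprobability T R | a <= (1 + D)%:E +
  \int[(S : probability T R)]_t (g t ^+ 2)%:E].
have mE : measurable E.
  rewrite -[E]setTI; apply: emeasurable_fun_c_infty => //.
  by apply: emeasurable_funD.
have rE : rho E = 1.
  apply: Frho => // S FS; rewrite /E /=.
  rewrite (le_trans (chi2_ge_variational P S mg g0))//.
  rewrite leeD2r// EFinD leeD2l// (le_trans _ FD)//.
  exact: chi2_le_diameter.
rewrite -[a](probability_integral_cst rho).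
have rE' : rho (~` E) = 0 by rewrite probability_setC// rE subee.
apply: ae_ge0_le_integral => //.
- by move=> S _; rewrite adde_ge0// lee_fin addr_ge0.
- by apply: emeasurable_funD.
- exists (~` E); split; [exact: measurableC|exact: rE'|].
  by move=> S /=; apply: contra_not => Sh _.
Qed.

Lemma chi2_capacity_lty F : F !=set0 -> chi2_diameter F < +oo ->
  chi2_capacity F < +oo.
Proof.
move=> [P0 FP0] FD.
have [D FDD] : exists D : R, chi2_diameter F <= D%:E.
  exists (fine (chi2_diameter F)); rewrite fineK// ge0_fin_numE//.
  by rewrite (le_trans _ (chi2_le_diameter FP0 FP0))// chi2_ge0.
apply: (@le_lt_trans _ _ (D + 2)%:E); last exact: ltry.
apply: ge_ereal_sup => _ [rho Frho <-].
apply: (prior_on_integral_le Frho) => P; first exact: chi2_ge0.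
by move=> FP; exact: chi2_mixture_le Frho FP FDD.
Qed.

(** The supremum of the squared Hellinger distances must stay below 2: otherwise [hellinger_Delta]
    would be [+oo], whose [fine] is 0. *)
Lemma hellinger_Delta_ge1 F : F !=set0 -> chi2_diameter F < +oo ->
  (1 <= fine (hellinger_Delta F))%R.
Proof.
move=> [P0 FP0] FD.
have D0 : 0 <= chi2_diameter F.
  by rewrite (le_trans _ (chi2_le_diameter FP0 FP0))// chi2_ge0.
pose D := fine (chi2_diameter F).
have DE : chi2_diameter F = D%:E by rewrite fineK// ge0_fin_numE.
have {}D0 : (0 <= D)%R by rewrite -lee_fin -DE.
(* Then [s^2 (D + 1) = s / 2 <= 1 / 4], as [hellinger2_le] requires. *)
pose s := (2^-1 / (D + 1))%R.
have s0 : (0 < s)%R by rewrite divr_gt0// ltr_wpDl.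
have D1 : (D + 1 != 0)%R by rewrite gt_eqF// ltr_wpDl.
have s1 : (s <= 2^-1)%R.
  by rewrite /s ler_pdivrMr ?ltr_wpDl// ler_peMr// lerDr.
have sD : (s ^+ 2 * (D + 1) <= 2^-1)%R.
  rewrite [leLHS](_ : _ = s * 2^-1)%R; last by rewrite /s; field.
  lra.
rewrite /hellinger_Delta; set H := ereal_sup _.
have Hle : H <= (2 - s)%:E.
  apply: ge_ereal_sup => _ [P FP [Q FQ <-]].
  by apply: (@hellinger2_le _ _ _ P Q D s) => //; rewrite -DE chi2_le_diameter.
have H0 : 0 <= H.
  apply: (@le_trans _ _ (hellinger2 P0 P0)).
    by apply: integral_ge0 => t _; exact: sqre_ge0.
  by apply: ereal_sup_ubound; exists P0 => //; exists P0.
have : H \is a fin_num by rewrite ge0_fin_numE// (le_lt_trans Hle)// ltry.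
move: Hle H0; case: H => // h; rewrite !lee_fin => hs h0 _.
rewrite -EFinM -EFinD expe2 -EFinM inver.
have x0 : (0 < 1 - 2^-1 * h)%R by lra.
rewrite mulf_eq0 gt_eqF//=.
rewrite invf_ge1 ?mulr_gt0//; nra.
Qed.

End capacity.

(** * Quotients of densities; the uniform prior on finitely many laws and its mixture *)

Section density_algebra.
Context (d : measure_display) (T : measurableType d) (R : realType).
Implicit Types (P Q S : probability T R) (L M : T -> R).

Lemma has_density_id P : has_density (fun=> 1%R) P P.
Proof. by split=> // A mA; rewrite integral_cst// mul1e. Qed.

(** The chain rule for densities; as [M] is positive everywhere, no null set has to be discarded. *)
Lemma has_density_div L M P Q S : has_density L P Q -> has_density M S Q ->
  (forall t, (0 < M t)%R) -> has_density (fun t => L t / M t)%R P S.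
Proof.
move=> [mL L0 PL] MS M0; have [mM M0' _] := MS.
have mLM := measurable_fun_div mL mM M0'.
have LM0 t : (0 <= L t / M t)%R by rewrite divr_ge0.
split=> // A mA; rewrite PL// integral_mkcond [RHS]integral_mkcond.
rewrite (density_integral MS); last 2 first.
- by apply/(measurable_restrictT _ mA)/measurable_funTS/measurable_EFinP.
- by move=> t; rewrite patchE; case: ifP => // _; rewrite lee_fin.
apply: eq_integral => t _; rewrite !patchE; case: ifP => _; last by rewrite mul0e.
by rewrite -EFinM divfK// gt_eqF.
Qed.

End density_algebra.

Section uniform_prior.
Context (d : measure_display) (T : measurableType d) (R : realType) (m : nat).
Variable P : 'I_m.+1 -> probability T R.

(** [inord] is there because [msum] takes a sequence of measures indexed by the natural numbers. A
    law that occurs several times among the [P k] is weighted by its multiplicity. *)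
Definition uniform_prior : set (pprobability T R) -> \bar R :=
  mscale ((m.+1%:R : R)^-1%:nng)%R
    (msum (fun k => \d_(P (inord k) : pprobability T R)) m.+1).

HB.instance Definition _ := Measure.on uniform_prior.

Let uniform_priorE A :
  uniform_prior A = (m.+1%:R^-1 : R)%R%:E * \sum_(k < m.+1) \d_(P k : pprobability T R) A.
Proof.
rewrite /uniform_prior /mscale /msum; congr (_ * _).
by apply: eq_bigr => k _; rewrite inord_val.
Qed.

Let uniform_prior1 A : (forall k, A (P k)) -> uniform_prior A = 1.
Proof.
move=> AP; rewrite uniform_priorE (eq_bigr (fun=> 1%R%:E)) => [|k _].
  by rewrite sumEFin sumr_const card_ord -EFinM mulVf.
by rewrite diracE mem_set.
Qed.

HB.instance Definition _ :=
  Measure_isProbability.Build _ _ _ uniform_prior (uniform_prior1 (fun=> I)).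

Lemma uniform_prior_on (F : set (probability T R)) : (forall k, F (P k)) ->
  prior_on F uniform_prior.
Proof. by move=> FP B _ FB; apply: uniform_prior1 => k; exact/FB/FP. Qed.

Lemma uniform_prior_integral (f : pprobability T R -> \bar R) :
  measurable_fun setT f -> (forall S, 0 <= f S) ->
  \int[uniform_prior]_S f S = (m.+1%:R^-1 : R)%R%:E * \sum_(k < m.+1) f (P k).
Proof.
move=> mf f0; rewrite ge0_integral_mscale//= ge0_integral_measure_sum//.
congr (_ * _); apply: eq_bigr => k _.
by rewrite integral_dirac// diracT mul1e inord_val.
Qed.

Definition uniform_mixture : probability T R := mixture uniform_prior.

Variables (Q : probability T R) (l : 'I_m.+1 -> T -> R).
Hypothesis lP : forall k, has_density (l k) (P k) Q.

Definition average_density t : R := (m.+1%:R^-1 * \sum_(k < m.+1) l k t)%R.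

Lemma average_densityP : has_density average_density uniform_mixture Q.
Proof.
have ml k : measurable_fun setT (l k) by case: (lP k).
have l0 k t : (0 <= l k t)%R by case: (lP k).
split=> [|t|A mA].
- by apply: measurable_funM => //; exact: measurable_sum.
- by rewrite mulr_ge0// sumr_ge0.
rewrite /uniform_mixture /= /mixture (uniform_prior_integral (measurable_eval mA))//.
under [RHS]eq_integral do rewrite EFinM -sumEFin.
rewrite ge0_integralZl_EFin//; last 2 first.
- by move=> t _; rewrite sume_ge0// => k _; rewrite lee_fin.
- apply: emeasurable_sum => k; apply/measurable_EFinP; exact: measurable_funTS.
rewrite ge0_integral_sum//; last 2 first.
- by move=> k; apply/measurable_EFinP; exact: measurable_funTS.
- by move=> k t _; rewrite lee_fin.
by congr (_ * _); apply: eq_bigr => k _; case: (lP k) => _ _ ->.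
Qed.

End uniform_prior.

(** * Second moments of the densities, bounded by the capacity *)

Section capacity_lower_bound.
Context (d : measure_display) (T : measurableType d) (R : realType) (m : nat).
Variable P : 'I_m.+1 -> probability T R.

(* [chi2 ^~ (uniform_mixture P)] need not be measurable; the maximum [G] of its
   variational lower bounds at the test functions [r k] is, and has the value
   [chi2 (P k) (uniform_mixture P)] at [P k]. *)
Lemma sum_second_moment_le_capacity (F : set (probability T R)) (C K : R)
    (r : 'I_m.+1 -> T -> R) :
  (forall k, F (P k)) -> chi2_capacity F <= C%:E ->
  (forall k, has_density (r k) (P k) (uniform_mixture P)) ->
  (forall k t, (r k t <= K)%R) ->
  \sum_(k < m.+1) \int[uniform_mixture P]_t (r k t ^+ 2)%:E <=
  (m.+1%:R * (1 + C))%:E.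
Proof.
move=> FP FC rP rK; pose q := uniform_mixture P.
have mr k : measurable_fun setT (r k) by case: (rP k).
have r0 k t : (0 <= r k t)%R by case: (rP k).
have mr2 k : measurable_fun setT (fun t => (r k t ^+ 2)%:E).
  by apply/measurable_EFinP; exact: measurable_funX.
have mEr k : measurable_fun setT (fun t => (r k t)%:E) by exact/measurable_EFinP.
have r20 k t : 0 <= (r k t ^+ 2)%:E by rewrite lee_fin sqr_ge0.
(* The bound [K] on the densities makes these moments finite, so that they may be subtracted in
   [g]. *)
pose v k := fine (\int[q]_t (r k t ^+ 2)%:E).
have vE k : \int[q]_t (r k t ^+ 2)%:E = (v k)%:E.
  rewrite fineK// ge0_fin_numE ?integral_ge0//.
  apply: (@le_lt_trans _ _ (\int[q]_t (K ^+ 2)%:E)).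
    apply: ge0_le_integralT => // t.
    by rewrite lee_fin ler_sqr// nnegrE// (le_trans (r0 k t)).
  by rewrite probability_integral_cst ltry.
have rPv k : \int[P k]_t (r k t)%:E = (v k)%:E.
  rewrite (density_integral (rP k))//; last by move=> t; rewrite lee_fin.
  by rewrite -vE; apply: eq_integral => t _; rewrite -EFinM expr2.
pose g k (S : pprobability T R) :=
  2 * \int[(S : probability T R)]_t (r k t)%:E - (v k + 1)%:E.
have mg k : measurable_fun setT (g k).
  apply: emeasurable_funB => //; apply: emeasurable_funM => //.
  by apply: measurable_integral_pprobability => // t; rewrite lee_fin.
have gchi k S : g k S <= chi2 S q.
  rewrite leeBlDr// (le_trans (chi2_ge_variational S q (mr k) (r0 k)))//.
  by rewrite vE addeAC [leLHS]addeC EFinD [(v k)%:E + 1]addeC addeA.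
pose G S := \big[maxe/0]_(k < m.+1) g k S.
have mG : measurable_fun setT G.
  rewrite /G; elim: (index_enum _) => [|k s IHs].
    under eq_fun do rewrite big_nil.
    exact: measurable_cst.
  under eq_fun do rewrite big_cons.
  exact: measurable_maxe.
have G0 S : 0 <= G S by exact: bigmax_ge_id.
have Gchi S : G S <= chi2 S q.
  by apply/bigmax_leP; split=> [|k _]; [exact: chi2_ge0|exact: gchi].
have : \int[uniform_prior P]_S G S <= C%:E.
  apply: (le_trans (ge0_le_integralT _ G0 Gchi)); apply: (le_trans _ FC).
  by apply: ereal_sup_ubound; exists (uniform_prior P) => //; exact: uniform_prior_on.
rewrite uniform_prior_integral// => GC.
under eq_bigr do rewrite -/q vE.
have : (m.+1%:R^-1 : R)%R%:E * \sum_(k < m.+1) (v k - 1)%:E <= C%:E.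
  apply: (le_trans _ GC); apply: lee_wpmul2l; first by rewrite lee_fin invr_ge0.
  apply: lee_sum => k _; apply: (@le_trans _ _ (g k (P k))).
    by rewrite /g rPv -EFinM -EFinB lee_fin; lra.
  exact: le_bigmax.
rewrite !sumEFin -EFinM !lee_fin sumrB sumr_const card_ord.
rewrite mulrC ler_pdivrMr// => H.
by rewrite mulrDr mulr1 -lerBlDl mulrC.
Qed.

End capacity_lower_bound.

(** * Cauchy-Schwarz inequality for the difference of two weights *)

Lemma le_of_forall_pos_sqrt (R : rcfType) (y M V : R) :
  (0 <= M)%R -> (0 <= V)%R ->
  (forall s, 0 < s -> y <= s / 2 * V + M ^+ 2 / (8 * s))%R ->
  (y <= M / 2 * Num.sqrt V)%R.
Proof.
move=> M0 V0 H; have [y0|y0] := leP y 0%R.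
  by rewrite (le_trans y0)// mulr_ge0// ?sqrtr_ge0// divr_ge0.
have [Vz|Vn] := eqVneq V 0%R.
  have M1 : (0 < M ^+ 2 + 1)%R by rewrite ltr_wpDl ?sqr_ge0.
  (* With [V = 0] this [s] turns the bound into [y <= y / 2 * M^2 / (M^2 + 1)], which is absurd for
     positive [y]. *)
  have s0 : (0 < (M ^+ 2 + 1) / (4 * y))%R by rewrite divr_gt0// mulr_gt0.
  have := H _ s0; rewrite Vz mulr0 add0r.
  rewrite [X in (_ <= X)%R](_ : _ = (M ^+ 2 / (M ^+ 2 + 1)) * (y / 2))%R; last first.
    by field; rewrite !gt_eqF.
  have : (M ^+ 2 / (M ^+ 2 + 1) <= 1)%R by rewrite ler_pdivrMr// mul1r lerDl.
  have : (0 <= M ^+ 2 / (M ^+ 2 + 1))%R by rewrite divr_ge0 ?sqr_ge0// ltW.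
  by nra.
have Vp : (0 < V)%R by rewrite lt0r Vn.
(* The choice [s = y / V] avoids the optimal [s = M / (2 sqrt V)], which is not positive if [M = 0];
   it yields [y <= y / 2 + M^2 V / (8 y)], that is, [y^2 <= M^2 V / 4]. *)
have := H _ (divr_gt0 y0 Vp).
rewrite [X in (_ <= X)%R](_ : _ = y / 2 + M ^+ 2 * V / 8 / y)%R; last first.
  by field; rewrite !gt_eqF.
rewrite -lerBlDl [X in (X <= _)%R](_ : _ = y / 2)%R; last by field.
rewrite ler_pdivlMr// => H'.
rewrite -(ler_sqr (ltW y0)) ?nnegrE; last first.
  by rewrite mulr_ge0// ?sqrtr_ge0// divr_ge0.
rewrite exprMn sqr_sqrtr// expr_div_n; lra.
Qed.

Section two_weights.
Context (d : measure_display) (T : measurableType d) (R : realType).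
Variables (mu : probability T R) (U W h : T -> R) (A B M N V : R).
Hypotheses (mU : measurable_fun setT U) (mW : measurable_fun setT W)
  (mh : measurable_fun setT h).
Hypotheses (U0 : forall t, (0 <= U t)%R) (W0 : forall t, (0 <= W t)%R)
  (hM : forall t, (0 <= h t <= M)%R) (M0 : (0 <= M)%R) (V0 : (0 <= V)%R).
Hypotheses (UA : \int[mu]_t (U t * h t)%:E = (N * A)%:E)
  (WB : \int[mu]_t (W t * h t)%:E = (N * B)%:E)
  (UN : \int[mu]_t (U t)%:E = N%:E) (WN : \int[mu]_t (W t)%:E = N%:E).
Hypothesis UWV : \int[mu]_t ((U t - W t) ^+ 2)%:E <= V%:E.

(* Cauchy-Schwarz for [U - W] and the centered [h - M / 2], in the form
   [x y <= s x ^ 2 / 2 + y ^ 2 / (2 s)], with terms moved across so that only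
   nonnegative functions are integrated. *)
Lemma weighted_integral_diff_le : (N * (A - B) <= M / 2 * Num.sqrt V)%R.
Proof.
apply: le_of_forall_pos_sqrt => // s s0.
have c1 : (0 <= M / 2)%R by rewrite divr_ge0.
have c2 : (0 <= s / 2)%R by rewrite divr_ge0// ltW.
have c3 : (0 <= M ^+ 2 / (8 * s))%R by rewrite divr_ge0 ?sqr_ge0// mulr_ge0// ltW.
have h0 t : (0 <= h t)%R by case/andP: (hM t).
have mEU : measurable_fun setT (fun t => (U t)%:E) by exact/measurable_EFinP.
have mEW : measurable_fun setT (fun t => (W t)%:E) by exact/measurable_EFinP.
have mUh : measurable_fun setT (fun t => (U t * h t)%:E).
  by apply/measurable_EFinP; exact: measurable_funM.
have mWh : measurable_fun setT (fun t => (W t * h t)%:E).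
  by apply/measurable_EFinP; exact: measurable_funM.
have mUW : measurable_fun setT (fun t => ((U t - W t) ^+ 2)%:E).
  by apply/measurable_EFinP; apply: measurable_funX; exact: measurable_funB.
have Uh0 t : 0 <= (U t * h t)%:E by rewrite lee_fin mulr_ge0.
have Wh0 t : 0 <= (W t * h t)%:E by rewrite lee_fin mulr_ge0.
have EU0 t : 0 <= (U t)%:E by rewrite lee_fin.
have EW0 t : 0 <= (W t)%:E by rewrite lee_fin.
have UW0 t : 0 <= ((U t - W t) ^+ 2)%:E by rewrite lee_fin sqr_ge0.
have cU0 t : 0 <= (M / 2)%:E * (U t)%:E by rewrite mule_ge0.
have cW0 t : 0 <= (M / 2)%:E * (W t)%:E by rewrite mule_ge0.
have cUW0 t : 0 <= (s / 2)%:E * ((U t - W t) ^+ 2)%:E by rewrite mule_ge0.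
have mcU : measurable_fun setT (fun t => (M / 2)%:E * (U t)%:E) by exact: emeasurable_funM.
have mcW : measurable_fun setT (fun t => (M / 2)%:E * (W t)%:E) by exact: emeasurable_funM.
have mcUW : measurable_fun setT (fun t => (s / 2)%:E * ((U t - W t) ^+ 2)%:E).
  exact: emeasurable_funM.
have f10 t : 0 <= (U t * h t)%:E + (M / 2)%:E * (W t)%:E by exact: adde_ge0.
have f20 t : 0 <= (W t * h t)%:E + (M / 2)%:E * (U t)%:E by exact: adde_ge0.
have mf2 : measurable_fun setT (fun t => (W t * h t)%:E + (M / 2)%:E * (U t)%:E).
  exact: emeasurable_funD.
have f30 t : 0 <= (s / 2)%:E * ((U t - W t) ^+ 2)%:E + (M ^+ 2 / (8 * s))%:E.
  by rewrite adde_ge0// lee_fin.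
have mf3 : measurable_fun setT
    (fun t => (s / 2)%:E * ((U t - W t) ^+ 2)%:E + (M ^+ 2 / (8 * s))%:E).
  by apply: emeasurable_funD.
have key t : (U t * h t)%:E + (M / 2)%:E * (W t)%:E <=
    ((W t * h t)%:E + (M / 2)%:E * (U t)%:E) +
    ((s / 2)%:E * ((U t - W t) ^+ 2)%:E + (M ^+ 2 / (8 * s))%:E).
  rewrite -!EFinM -!EFinD lee_fin.
  have hc : ((h t - M / 2) ^+ 2 <= (M / 2) ^+ 2)%R.
    by have /andP[h1 h2] := hM t; nra.
  have : (0 <= (s * (U t - W t) - (h t - M / 2)) ^+ 2 / (2 * s))%R.
    by rewrite divr_ge0 ?sqr_ge0// mulr_ge0// ltW.
  have : ((h t - M / 2) ^+ 2 / (2 * s) <= M ^+ 2 / (8 * s))%R.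
    rewrite [leRHS](_ : _ = (M / 2) ^+ 2 / (2 * s))%R; last by field; rewrite gt_eqF.
    by rewrite ler_pM2r// invr_gt0 mulr_gt0.
  rewrite [X in (0 <= X)%R -> _](_ : _ = s / 2 * (U t - W t) ^+ 2 -
    (U t - W t) * (h t - M / 2) + (h t - M / 2) ^+ 2 / (2 * s))%R; last first.
    by field; rewrite gt_eqF.
  by nra.
have := ge0_le_integralT mu f10 key.
rewrite (ge0_integralD mu measurableT (fun t _ => f20 t) mf2 (fun t _ => f30 t) mf3).
rewrite !ge0_integralD// !ge0_integralZl_EFin// UA WB UN WN probability_integral_cst.
have : \int[mu]_t ((U t - W t) ^+ 2)%:E \is a fin_num.
  by rewrite ge0_fin_numE ?integral_ge0// (le_lt_trans UWV)// ltry.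
move: UWV; case: (\int[mu]_t ((U t - W t) ^+ 2)%:E) => // w wV _.
rewrite -!EFinM -!EFinD lee_fin => H.
have : (s / 2 * w <= s / 2 * V)%R by rewrite ler_wpM2l// -lee_fin.
by lra.
Qed.

End two_weights.

(** * Second moment of a sum of orthogonal functions of the coordinates *)

Section orthogonal_sums.
Context (d : measure_display) (T : measurableType d) (R : realType).

(** The cross term vanishes because [a - b] has integral 0. The second moment of [a - b] may be
    infinite. *)
Lemma integral_affine_sqr (Q : probability T R) (a b : T -> R) (x c : R) :
  measurable_fun setT a -> measurable_fun setT b ->
  (forall t, (0 <= a t)%R) -> (forall t, (0 <= b t)%R) ->
  \int[Q]_t (a t)%:E = 1 -> \int[Q]_t (b t)%:E = 1 ->
  \int[Q]_t ((x + c * (a t - b t)) ^+ 2)%:E =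
  (x ^+ 2)%:E + (c ^+ 2)%:E * \int[Q]_t ((a t - b t) ^+ 2)%:E.
Proof.
(* Exchanging [a] and [b] changes the sign of [c]; once [x c >= 0], the cross term can be split
   between both sides with nonnegative coefficients. *)
wlog xc0 : a b c / (0 <= x * c)%R => [wlg|] ma mb a0 b0 Ia Ib.
  have [xc|/ltW xc] := leP 0%R (x * c)%R; first exact: wlg.
  have := wlg b a (- c)%R; rewrite mulrN oppr_ge0 => /(_ xc mb ma b0 a0 Ib Ia).
  rewrite sqrrN; under eq_integral do rewrite mulNr -mulrN opprB.
  move=> ->; congr (_ + _ * _); apply: eq_integral => t _.
  by rewrite -sqrrN opprB.
have y0 : (0 <= 2 * (x * c))%R by rewrite mulr_ge0.
have mEa : measurable_fun setT (fun t => (a t)%:E) by exact/measurable_EFinP.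
have mEb : measurable_fun setT (fun t => (b t)%:E) by exact/measurable_EFinP.
have mab : measurable_fun setT (fun t => ((a t - b t) ^+ 2)%:E).
  by apply/measurable_EFinP; apply: measurable_funX; exact: measurable_funB.
have mf : measurable_fun setT (fun t => ((x + c * (a t - b t)) ^+ 2)%:E).
  apply/measurable_EFinP; apply: measurable_funX; apply: measurable_funD => //.
  by apply: measurable_funM => //; exact: measurable_funB.
have Ea0 t : 0 <= (a t)%:E by rewrite lee_fin.
have Eb0 t : 0 <= (b t)%:E by rewrite lee_fin.
have ab0 t : 0 <= ((a t - b t) ^+ 2)%:E by rewrite lee_fin sqr_ge0.
have f0 t : 0 <= ((x + c * (a t - b t)) ^+ 2)%:E by rewrite lee_fin sqr_ge0.
have x20 : 0 <= (x ^+ 2)%:E by rewrite lee_fin sqr_ge0.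
have c20 : (0 <= c ^+ 2)%R by exact: sqr_ge0.
have yb0 t : 0 <= (2 * (x * c))%:E * (b t)%:E by rewrite mule_ge0.
have ya0 t : 0 <= (2 * (x * c))%:E * (a t)%:E by rewrite mule_ge0.
have cab0 t : 0 <= (c ^+ 2)%:E * ((a t - b t) ^+ 2)%:E by rewrite mule_ge0.
have myb : measurable_fun setT (fun t => (2 * (x * c))%:E * (b t)%:E).
  exact: emeasurable_funM.
have mya : measurable_fun setT (fun t => (2 * (x * c))%:E * (a t)%:E).
  exact: emeasurable_funM.
have mcab : measurable_fun setT (fun t => (c ^+ 2)%:E * ((a t - b t) ^+ 2)%:E).
  exact: emeasurable_funM.
have s0 t : 0 <= (x ^+ 2)%:E + (c ^+ 2)%:E * ((a t - b t) ^+ 2)%:E by exact: adde_ge0.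
have ms : measurable_fun setT (fun t => (x ^+ 2)%:E + (c ^+ 2)%:E * ((a t - b t) ^+ 2)%:E).
  exact: emeasurable_funD.
have : \int[Q]_t (((x + c * (a t - b t)) ^+ 2)%:E + (2 * (x * c))%:E * (b t)%:E) =
    \int[Q]_t ((x ^+ 2)%:E + (c ^+ 2)%:E * ((a t - b t) ^+ 2)%:E +
      (2 * (x * c))%:E * (a t)%:E).
  by apply: eq_integral => t _; rewrite -!EFinM -!EFinD; congr EFin; ring.
rewrite (ge0_integralD Q measurableT (fun t _ => s0 t) ms (fun t _ => ya0 t) mya).
rewrite !ge0_integralD// !ge0_integralZl_EFin// Ia Ib probability_integral_cst.
by rewrite !mule1 => /(congr1 (fun z => z - (2 * (x * c))%:E)); rewrite !addeK.
Qed.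

Lemma marginal_integral n (mu : probability (n.-tuple T) R) Q i (f : T -> \bar R) :
  product_law mu Q -> measurable_fun setT f -> (forall t, 0 <= f t) ->
  \int[mu]_x f (tnth x i) = \int[Q i]_t f t.
Proof.
move=> muQ mf f0; rewrite (product_law_resample i muQ)//; last first.
  exact: measurable_tnth_comp.
rewrite -[RHS](probability_integral_cst mu); apply: eq_integral => x _.
by apply: eq_integral => t _; rewrite tnth_upd eqxx.
Qed.

Variables (n : nat) (mu : probability (n.-tuple T) R) (Q : 'I_n -> probability T R)
  (i : 'I_n) (f : T -> R) (c a b : 'I_n -> T -> R).
Hypothesis muQ : product_law mu Q.
Hypotheses (mf : measurable_fun setT f) (mc : forall k, measurable_fun setT (c k))
  (ma : forall k, measurable_fun setT (a k)) (mb : forall k, measurable_fun setT (b k))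
  (a0 : forall k t, (0 <= a k t)%R) (b0 : forall k t, (0 <= b k t)%R).

(** Taking [b = 0] gives the two weights compared below; their difference has the same form, with
    [a] and [b] the two families of densities. *)
Definition coordinate_sum (s : seq 'I_n) (x : n.-tuple T) : R :=
  (f (tnth x i) +
   \sum_(k <- s) c k (tnth x i) * (a k (tnth x k) - b k (tnth x k)))%R.

(* Pythagoras: the summands are orthogonal because the [k]-th one is centered in
   the coordinate [k], on which the others do not depend. *)
Lemma coordinate_sum_sqr (s : seq 'I_n) : uniq s -> i \notin s ->
  (forall k, k \in s -> \int[Q k]_t (a k t)%:E = 1) ->
  (forall k, k \in s -> \int[Q k]_t (b k t)%:E = 1) ->
  \int[mu]_x (coordinate_sum s x ^+ 2)%:E =
  \int[Q i]_t (f t ^+ 2)%:E + \sum_(k <- s)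
    \int[Q i]_t (c k t ^+ 2)%:E * \int[Q k]_t ((a k t - b k t) ^+ 2)%:E.
Proof.
have mtn k (g : T -> R) : measurable_fun setT g ->
    measurable_fun setT (fun x : n.-tuple T => g (tnth x k)).
  exact: measurable_tnth_comp.
have msum s' : measurable_fun setT (coordinate_sum s').
  apply: measurable_funD; first exact: mtn.
  apply: measurable_sum => k; apply: measurable_funM; first exact: mtn.
  by apply: measurable_funB; exact: mtn.
elim: s => [_ _ _ _|k s IHs]/=.
  rewrite big_nil adde0 -(marginal_integral i muQ); last 2 first.
  - by apply/measurable_EFinP; exact: measurable_funX.
  - by move=> t; rewrite lee_fin sqr_ge0.
  by apply: eq_integral => x _; rewrite /coordinate_sum big_nil addr0.
move=> /andP[ks us]; rewrite inE negb_or => /andP[ik is_] Ia Ib.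
have {}IHs := IHs us is_ (fun k' k's => Ia k' (mem_behead (s := k :: s) k's))
  (fun k' k's => Ib k' (mem_behead (s := k :: s) k's)).
have V0 : 0 <= \int[Q k]_t ((a k t - b k t) ^+ 2)%:E.
  by apply: integral_ge0 => t _; rewrite lee_fin sqr_ge0.
(* Integrate the coordinate [k] first: the remaining sum and the factor [c k] are then the constants
   of [integral_affine_sqr]. *)
rewrite (product_law_resample k muQ); last 2 first.
- by apply/measurable_EFinP; exact: measurable_funX.
- by move=> x; rewrite lee_fin sqr_ge0.
transitivity (\int[mu]_x ((coordinate_sum s x ^+ 2)%:E +
    (c k (tnth x i) ^+ 2)%:E * \int[Q k]_t ((a k t - b k t) ^+ 2)%:E)).
  apply: eq_integral => x _; rewrite -integral_affine_sqr//.
  - apply: eq_integral => t _; congr ((_ ^+ 2)%R%:E).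
    rewrite /coordinate_sum big_cons !tnth_upd eqxx (negbTE ik) addrCA addrC.
    congr (_ + _ + _)%R; rewrite big_seq [RHS]big_seq; apply: eq_bigr => k' k's.
    rewrite !tnth_upd; case: eqP => // kk'.
    by move: ks; rewrite -kk' k's.
  - by apply: Ia; rewrite mem_head.
  - by apply: Ib; rewrite mem_head.
have mck : measurable_fun setT (fun t => (c k t ^+ 2)%:E).
  by apply/measurable_EFinP; exact: measurable_funX.
have ck0 t : 0 <= (c k t ^+ 2)%:E by rewrite lee_fin sqr_ge0.
have mckt : measurable_fun setT (fun x : n.-tuple T => (c k (tnth x i) ^+ 2)%:E).
  exact: (measurable_tnth_comp i mck).
rewrite ge0_integralD//; last 4 first.
- by move=> x _; rewrite lee_fin sqr_ge0.
- by apply/measurable_EFinP; exact: measurable_funX.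
- by move=> x _; rewrite mule_ge0.
- by apply: emeasurable_funM.
rewrite IHs ge0_integralZr// (marginal_integral i muQ mck)// big_cons.
by rewrite -addeA [X in _ + X]addeC.
Qed.

End orthogonal_sums.

(** * Hiding the changed observation among the others *)

Section exchange.
Context (d : measure_display) (T : measurableType d) (R : realType) (m : nat).
Variables (P : 'I_m.+1 -> probability T R) (F : set (probability T R)) (D C : R).
Hypotheses (FP : forall k, F (P k)) (chiD : forall a b, chi2 (P a) (P b) <= D%:E)
  (FC : chi2_capacity F <= C%:E) (C0 : (0 <= C)%R).
Variable (mu : probability (m.+1.-tuple T) R).
Hypothesis muP : product_law mu P.
Variable i : 'I_m.+1.
Hypothesis i0 : i != ord0.

Definition symmetric_off0 (S : Type) (H : m.+1.-tuple T -> S) :=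
  forall j k x, j != ord0 -> k != ord0 -> H (permute (tperm j k) x) = H x.

(** [nu0] is the law in which the observation 0 is resampled from [P i]; in the reference law [nu]
    the observation [i] moreover follows the average [q]. [Q0] and [Q] are their marginals. *)
Let q := uniform_mixture P.
Let nu0 := resample mu ord0 (P i).
Let nu := resample nu0 i q.
Let Q0 := upd_family P ord0 (P i).
Let Q := upd_family Q0 i q.

Let nu0Q0 : product_law nu0 Q0. Proof. exact: resample_law. Qed.
Let nuQ : product_law nu Q. Proof. exact: resample_law. Qed.

Section symmetric_integrals.
Variable H : m.+1.-tuple T -> \bar R.
Hypotheses (mH : measurable_fun setT H) (H0 : forall x, 0 <= H x)
  (Hsym : symmetric_off0 H).

Let A := \int[mu]_x H (permute (tperm ord0 i) x).
Let B := \int[nu0]_x H x.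

(** The weight moves the observation [i] from [q] to [P k] and the observation [k] from [P k] to
    [P S]. *)
Let two_densities k S r L : k != ord0 -> k != i ->
  has_density r (P k) q -> has_density L (P S) (P k) ->
  \int[nu]_x ((r (tnth x i) * L (tnth x k))%:E * H x) =
  \int[resample (resample nu k (P S)) i (P k)]_x H x.
Proof.
move=> k0 ki rP LP; have [mr r0 _] := rP; have [mL L0 _] := LP.
have LP' : has_density L (P S) (Q k).
  by rewrite /Q /Q0 /upd_family (negbTE k0) (negbTE ki).
have rP' : has_density r (P k) (upd_family Q k (P S) i).
  by rewrite /Q /upd_family eqxx eq_sym (negbTE ki).
rewrite (resample_density (resample_law k (P S) nuQ) rP')//.
have mrH : measurable_fun setT (fun x : m.+1.-tuple T => (r (tnth x i))%:E * H x).
  apply: emeasurable_funM => //; apply/measurable_EFinP.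
  exact: measurable_tnth_comp.
rewrite (resample_density nuQ LP')//; last by move=> x; rewrite mule_ge0// lee_fin.
by apply: eq_integral => x _; rewrite muleA -EFinM mulrC.
Qed.

(** Under the weighted law the observations 0, [i], [k] follow [P i], [P k], [P ord0]. Exchanging
    [i] and [k], which [H] does not notice, leaves the law of the sample with 0 and [i]
    exchanged. *)
Lemma integral_moved_first k r L : k != ord0 -> k != i ->
  has_density r (P k) q -> has_density L (P ord0) (P k) ->
  \int[nu]_x ((r (tnth x i) * L (tnth x k))%:E * H x) = A.
Proof.
move=> k0 ki rP LP; rewrite (two_densities k0 ki rP LP) /A.
rewrite -(@permute_integral _ _ _ _ mu _ P (tperm i k * tperm ord0 i)%g)//.
  apply: eq_integral => x _; rewrite -[RHS](Hsym _ i0 k0); congr H.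
  by apply: eq_from_tnth => j; rewrite /permute !tnth_mktuple permM.
have := resample_law i (P k) (resample_law k (P ord0) nuQ).
congr product_law; apply/funext => j.
rewrite /upd_family /Q /Q0 /upd_family /= permM.
have [->|ji] := eqVneq j i.
  by rewrite tpermL tpermD// eq_sym.
have [->|jk] := eqVneq j k; first by rewrite tpermR tpermR.
rewrite (@tpermD _ i k j) 1?eq_sym//.
have [->|j0] := eqVneq j ord0; first by rewrite tpermL.
by rewrite tpermD 1?eq_sym.
Qed.

(** Here the observations 0, [i], [k] follow [P i], [P k], [P i]; exchanging [i] and [k] gives back
    [nu0]. *)
Lemma integral_moved_self k r L : k != ord0 -> k != i ->
  has_density r (P k) q -> has_density L (P i) (P k) ->
  \int[nu]_x ((r (tnth x i) * L (tnth x k))%:E * H x) = B.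
Proof.
move=> k0 ki rP LP; rewrite (two_densities k0 ki rP LP) /B.
rewrite -(@permute_integral _ _ _ _ nu0 _ Q0 (tperm i k))//.
  by apply: eq_integral => x _; rewrite Hsym.
have := resample_law i (P k) (resample_law k (P i) nuQ).
congr product_law; apply/funext => j.
rewrite /upd_family /Q /Q0 /upd_family /=.
have [->|ji] := eqVneq j i; first by rewrite tpermL (negbTE k0).
have [->|jk] := eqVneq j k; first by rewrite tpermR (negbTE i0).
by rewrite tpermD 1?eq_sym.
Qed.

Lemma integral_fixed_first r : has_density r (P ord0) q ->
  \int[nu]_x ((r (tnth x i))%:E * H x) = A.
Proof.
move=> rP; have rP' : has_density r (P ord0) (Q i).
  by rewrite /Q /upd_family eqxx.
rewrite -(resample_density nuQ rP')// /A.
rewrite -(@permute_integral _ _ _ _ mu _ P (tperm ord0 i))//.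
have := resample_law i (P ord0) nuQ.
congr product_law; apply/funext => j; rewrite /upd_family /Q /Q0 /upd_family /=.
have [->|ji] := eqVneq j i; first by rewrite tpermR.
have [->|j0] := eqVneq j ord0; first by rewrite tpermL.
by rewrite tpermD 1?eq_sym.
Qed.

Lemma integral_fixed_self r : has_density r (P i) q ->
  \int[nu]_x ((r (tnth x i))%:E * H x) = B.
Proof.
move=> rP; have rP' : has_density r (P i) (Q i).
  by rewrite /Q /upd_family eqxx.
rewrite -(resample_density nuQ rP')// /B.
apply: product_law_integral nu0Q0.
have := resample_law i (P i) nuQ.
congr product_law; apply/funext => j; rewrite /upd_family /Q /Q0 /upd_family /=.
by have [->|ji] := eqVneq j i; first by rewrite (negbTE i0).
Qed.

End symmetric_integrals.

Variables (h : m.+1.-tuple T -> R) (M : R).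
Hypotheses (mh : measurable_fun setT h) (hM : forall x, (0 <= h x <= M)%R)
  (hsym : symmetric_off0 h).

(** Each of [A] and [B] has [m] representations as a weighted integral over [nu]: one leaves the
    changed observation at [i], the others move it to some [k] other than 0 and [i]. The sums [U]
    and [W] of the weights are compared in L2. *)
Lemma exchange_le (A B : R) :
  \int[mu]_x (h (permute (tperm ord0 i) x))%:E = A%:E ->
  \int[resample mu ord0 (P i)]_x (h x)%:E = B%:E ->
  (m%:R * (B - A) <= M / 2 * Num.sqrt (5 * m.+1%:R * D * (1 + C)))%R.
Proof.
move=> hA hB.
have h0 x : (0 <= h x)%R by case/andP: (hM x).
have M0 : (0 <= M)%R.
  by have /andP[/le_trans] := hM [tuple point | j < m.+1]; apply.
have D0 : (0 <= D)%R by rewrite -lee_fin (le_trans (chi2_ge0 (P i) (P i))).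
have /choice[L LP] : forall ab : 'I_m.+1 * 'I_m.+1, exists L : T -> R,
    has_density L (P ab.1) (P ab.2) /\
    \int[P ab.2]_t ((L t - 1) ^+ 2)%:E <= D%:E.
  move=> [a b]; have [|L LP LD] := @chi2_density _ _ _ (P a) (P b).
    by rewrite (le_lt_trans (chiD _ _))// ltry.
  by exists L; split => //; exact: le_trans LD (chiD _ _).
pose l (a : 'I_m.+1) : T -> R := if a == i then (fun=> 1%R) else L (a, i).
have lP a : has_density (l a) (P a) (P i).
  by rewrite /l; case: eqP => [->|_]; [exact: has_density_id|case: (LP (a, i))].
have l0 a t : (0 <= l a t)%R by case: (lP a).
have ml a : measurable_fun setT (l a) by case: (lP a).
pose lbar := average_density l.
have lbarP : has_density lbar q (P i) by exact: average_densityP.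
have n0 : (0 < m.+1%:R :> R)%R by [].
have l_lbar a t : (l a t <= m.+1%:R * lbar t)%R.
  rewrite /lbar /average_density mulrA divff// mul1r (bigD1 a)//= lerDl.
  by rewrite sumr_ge0.
have lbar0 t : (0 < lbar t)%R.
  rewrite -(pmulr_rgt0 _ n0) (lt_le_trans _ (l_lbar i t))//.
  by rewrite /l eqxx.
pose r (a : 'I_m.+1) t : R := (l a t / lbar t)%R.
have rP a : has_density (r a) (P a) q by exact: has_density_div (lP a) lbarP lbar0.
have mr a : measurable_fun setT (r a) by case: (rP a).
have r0 a t : (0 <= r a t)%R by case: (rP a).
have rn a t : (r a t <= m.+1%:R)%R by rewrite /r ler_pdivrMr.
have Lden a b : has_density (L (a, b)) (P a) (P b) by case: (LP (a, b)).
have mL ab : measurable_fun setT (L ab) by case: ab => a b; case: (Lden a b).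
have L0 ab t : (0 <= L ab t)%R by case: ab => a b; case: (Lden a b).
pose s := [seq k <- enum 'I_m.+1 | (k != ord0) && (k != i)].
have us : uniq s by rewrite filter_uniq// enum_uniq.
have sP k : k \in s -> k != ord0 /\ k != i.
  by rewrite mem_filter => /andP[/andP[]].
have is_ : i \notin s by rewrite mem_filter eqxx andbF.
have s_size : m = (size s).+1.
  have : perm_eq [:: ord0, i & s] (enum 'I_m.+1).
    apply: uniq_perm; rewrite ?enum_uniq//=.
      by rewrite inE eq_sym (negbTE i0) us is_ mem_filter eqxx.
    move=> k; rewrite !inE mem_filter mem_enum andbT.
    by case: eqP => //=; case: eqP.
  by move/perm_size => /=; rewrite size_enum_ord => -[].
pose U := coordinate_sum i (r ord0) r (fun k => L (ord0, k)) (fun _ _ => 0%R) s.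
pose W := coordinate_sum i (r i) r (fun k => L (i, k)) (fun _ _ => 0%R) s.
have mcs (f : T -> R) (a : 'I_m.+1 -> T -> R) :
    measurable_fun setT f -> (forall k, measurable_fun setT (a k)) ->
    measurable_fun setT (coordinate_sum i f r a (fun _ _ => 0%R) s).
  move=> mf ma; apply: measurable_funD; first exact: measurable_tnth_comp.
  apply: measurable_sum => k; apply: measurable_funM.
    exact: measurable_tnth_comp.
  by apply: measurable_funB => //; exact: measurable_tnth_comp.
have cs0 (f : T -> R) (a : 'I_m.+1 -> T -> R) :
    (forall t, (0 <= f t)%R) -> (forall k t, (0 <= a k t)%R) ->
    forall x, (0 <= coordinate_sum i f r a (fun _ _ => 0%R) s x)%R.
  move=> f0 a0 x; rewrite addr_ge0// sumr_ge0// => k _.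
  by rewrite subr0 mulr_ge0.
have csH (f : T -> R) (a : 'I_m.+1 -> T -> R) (H : m.+1.-tuple T -> R) (K : R) :
    measurable_fun setT f -> (forall k, measurable_fun setT (a k)) ->
    (forall t, (0 <= f t)%R) -> (forall k t, (0 <= a k t)%R) ->
    measurable_fun setT H -> (forall x, (0 <= H x)%R) ->
    \int[nu]_x ((f (tnth x i))%:E * (H x)%:E) = K%:E ->
    (forall k, k \in s ->
      \int[nu]_x ((r k (tnth x i) * a k (tnth x k))%:E * (H x)%:E) = K%:E) ->
    \int[nu]_x (coordinate_sum i f r a (fun _ _ => 0%R) s x * H x)%:E =
      (m%:R * K)%:E.
  move=> mf ma f0 a0 mH H0 fK aK.
  have mt g k : measurable_fun setT g ->
      measurable_fun setT (fun x : m.+1.-tuple T => g (tnth x k) : R).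
    exact: measurable_tnth_comp.
  transitivity (\int[nu]_x ((f (tnth x i))%:E * (H x)%:E +
      \sum_(k <- s) ((r k (tnth x i) * a k (tnth x k))%:E * (H x)%:E))).
    apply: eq_integral => x _; rewrite -EFinM sumEFin -EFinD; congr EFin.
    rewrite mulrDl mulr_suml; congr (_ + _)%R.
    by apply: eq_bigr => k _; rewrite subr0.
  have mraH k : measurable_fun setT (fun x : m.+1.-tuple T =>
      (r k (tnth x i) * a k (tnth x k))%:E * (H x)%:E).
    apply: emeasurable_funM; last exact/measurable_EFinP.
    by apply/measurable_EFinP; apply: measurable_funM; exact: mt.
  have raH0 k (x : m.+1.-tuple T) :
      0 <= (r k (tnth x i) * a k (tnth x k))%:E * (H x)%:E.
    by apply: mule_ge0; rewrite lee_fin// mulr_ge0.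
  rewrite ge0_integralD//; last 4 first.
  - by move=> x _; apply: mule_ge0; rewrite lee_fin.
  - apply: emeasurable_funM; last exact/measurable_EFinP.
    by apply/measurable_EFinP; exact: mt.
  - by move=> x _; exact: sume_ge0.
  - exact: emeasurable_sum.
  rewrite ge0_integral_sum// fK big_seq (eq_bigr (fun=> K%:E))//.
  rewrite -big_seq sumEFin big_const_seq count_predT iter_addr addr0 -EFinD.
  by rewrite -mulrS -s_size mulr_natl.
have m1 : measurable_fun setT (fun _ : m.+1.-tuple T => 1%R : R).
  exact: measurable_cst.
have mEh : measurable_fun setT (fun x => (h x)%:E) by exact/measurable_EFinP.
have mE1 : measurable_fun setT (fun _ : m.+1.-tuple T => 1%:E : \bar R) by [].
have Eh0 x : 0 <= (h x)%:E by rewrite lee_fin.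
have sym1 : symmetric_off0 (fun _ : m.+1.-tuple T => 1%:E : \bar R) by [].
have Ehsym : symmetric_off0 (fun x => (h x)%:E) by move=> j k x ? ?; rewrite hsym.
have E10 (x : m.+1.-tuple T) : 0 <= 1%:E :> \bar R by rewrite lee_fin.
have A1 : \int[mu]_x (1%:E : \bar R) = 1%:E by exact: probability_integral_cst.
have B1 : \int[nu0]_x (1%:E : \bar R) = 1%:E by exact: probability_integral_cst.
have Uh : \int[nu]_x (U x * h x)%:E = (m%:R * A)%:E.
  apply: csH => //.
    exact: etrans (integral_fixed_first mEh Eh0 (rP _)) hA.
  move=> k /sP[k0 ki].
  exact: etrans (integral_moved_first mEh Eh0 Ehsym k0 ki (rP _) (Lden _ _)) hA.
have Wh : \int[nu]_x (W x * h x)%:E = (m%:R * B)%:E.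
  apply: csH => //.
    exact: etrans (integral_fixed_self mEh Eh0 (rP _)) hB.
  move=> k /sP[k0 ki].
  exact: etrans (integral_moved_self mEh Eh0 Ehsym k0 ki (rP _) (Lden _ _)) hB.
have U1 : \int[nu]_x (U x)%:E = m%:R%:E.
  rewrite -[m%:R in RHS]mulr1 -(csH (r ord0) (fun k => L (ord0, k)) (fun=> 1%R))//.
  - by apply: eq_integral => x _; rewrite mulr1.
  - exact: etrans (integral_fixed_first mE1 E10 (rP _)) A1.
  move=> k /sP[k0 ki].
  exact: etrans (integral_moved_first mE1 E10 sym1 k0 ki (rP _) (Lden _ _)) A1.
have W1 : \int[nu]_x (W x)%:E = m%:R%:E.
  rewrite -[m%:R in RHS]mulr1 -(csH (r i) (fun k => L (i, k)) (fun=> 1%R))//.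
  - by apply: eq_integral => x _; rewrite mulr1.
  - exact: etrans (integral_fixed_self mE1 E10 (rP _)) B1.
  move=> k /sP[k0 ki].
  exact: etrans (integral_moved_self mE1 E10 sym1 k0 ki (rP _) (Lden _ _)) B1.
have V0 : (0 <= 5 * m.+1%:R * D * (1 + C))%R by rewrite !mulr_ge0// addr_ge0.
apply: (@weighted_integral_diff_le _ _ _ nu W U h B A M m%:R) => //.
- exact: mcs.
- exact: mcs.
- exact: cs0.
- exact: cs0.
have -> : \int[nu]_x ((W x - U x) ^+ 2)%:E = \int[nu]_x
    (coordinate_sum i (fun t => r ord0 t - r i t)%R r (fun k => L (ord0, k))
      (fun k => L (i, k)) s x ^+ 2)%:E.
  apply: eq_integral => x _; rewrite -sqrrN opprB; congr ((_ ^+ 2)%R%:E).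
  rewrite /U /W /coordinate_sum opprD addrACA; congr (_ + _)%R.
  by rewrite -sumrB; apply: eq_bigr => k _; rewrite !subr0 -mulrBr.
have Qi : Q i = q by rewrite /Q /upd_family eqxx.
have Qk k : k \in s -> Q k = P k.
  by move=> /sP[k0 ki]; rewrite /Q /Q0 /upd_family (negbTE k0) (negbTE ki).
rewrite (coordinate_sum_sqr nuQ)//; last 3 first.
- exact: measurable_funB.
- by move=> k ks; rewrite Qk//; exact: density_integral1.
- by move=> k ks; rewrite Qk//; exact: density_integral1.
have fi : \int[Q i]_t ((r ord0 t - r i t) ^+ 2)%:E <= (m.+1%:R * D)%:E.
  rewrite Qi (density_integral lbarP); last 2 first.
  - by apply/measurable_EFinP; apply: measurable_funX; exact: measurable_funB.
  - by move=> t; rewrite lee_fin sqr_ge0.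
  apply: (@le_trans _ _ (\int[P i]_t (m.+1%:R%:E * ((L (ord0, i) t - 1) ^+ 2)%:E))).
    apply: ge0_le_integralT => t; first by rewrite mule_ge0// lee_fin ?sqr_ge0// ltW.
    rewrite -!EFinM lee_fin /r /l eqxx eq_sym (negbTE i0) -mulrBl.
    set y := L (ord0, i) t.
    rewrite [leLHS](_ : _ = (y - 1) ^+ 2 / lbar t)%R; last by field; rewrite gt_eqF.
    rewrite mulrC ler_wpM2r ?sqr_ge0// -(mul1r (lbar t)^-1)%R ler_pdivrMr//.
    by have := l_lbar i t; rewrite /l eqxx.
  rewrite ge0_integralZl_EFin//; last 2 first.
  - by move=> t _; rewrite lee_fin sqr_ge0.
  - by apply/measurable_EFinP; apply: measurable_funX; exact: measurable_funB.
  by rewrite EFinM lee_wpmul2l// ?lee_fin//; case: (LP (ord0, i)).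
have gk k : k \in s ->
    \int[Q k]_t ((L (ord0, k) t - L (i, k) t) ^+ 2)%:E <= (4 * D)%:E.
  move=> ks; rewrite Qk//.
  have mLk j : measurable_fun setT (fun t => ((L (j, k) t - 1) ^+ 2)%:E).
    by apply/measurable_EFinP; apply: measurable_funX; exact: measurable_funB.
  have Lk0 j t : 0 <= ((L (j, k) t - 1) ^+ 2)%:E by rewrite lee_fin sqr_ge0.
  have m2Lk j : measurable_fun setT (fun t => 2%:E * ((L (j, k) t - 1) ^+ 2)%:E).
    exact: emeasurable_funM.
  have Lk20 j t : 0 <= 2%:E * ((L (j, k) t - 1) ^+ 2)%:E by rewrite mule_ge0.
  apply: (@le_trans _ _ (\int[P k]_t (2%:E * ((L (ord0, k) t - 1) ^+ 2)%:E +
      2%:E * ((L (i, k) t - 1) ^+ 2)%:E))).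
    apply: ge0_le_integralT => t; first by rewrite lee_fin sqr_ge0.
    rewrite -!EFinM -EFinD lee_fin -subr_ge0.
    rewrite [leRHS](_ : _ = (L (ord0, k) t + L (i, k) t - 2) ^+ 2)%R ?sqr_ge0//.
    by ring.
  rewrite ge0_integralD// !ge0_integralZl_EFin//.
  have [[_ H1] [_ H2]] := (LP (ord0, k), LP (i, k)).
  rewrite (_ : 4 * D = 2 * D + 2 * D)%R; last by ring.
  by rewrite (EFinD (2 * D)%R) (EFinM 2%R D) leeD// lee_wpmul2l.
have rk20 k : 0 <= \int[q]_t (r k t ^+ 2)%:E.
  by apply: integral_ge0 => t _; rewrite lee_fin sqr_ge0.
have cap := sum_second_moment_le_capacity FP FC rP rn.
rewrite Qi in fi *.
apply: (@le_trans _ _ ((m.+1%:R * D)%:E +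
    (4 * D)%:E * \sum_(k < m.+1) \int[q]_t (r k t ^+ 2)%:E)).
  apply: leeD => //.
  apply: (@le_trans _ _ (\sum_(k <- s) (4 * D)%:E * \int[q]_t (r k t ^+ 2)%:E)).
    rewrite big_seq [leRHS]big_seq; apply: lee_sum => k ks.
    by rewrite muleC lee_wpmul2r// gk.
  rewrite -ge0_sume_distrr; last by move=> k _.
  apply: lee_wpmul2l; first by rewrite lee_fin mulr_ge0.
  rewrite /s big_filter big_enum_cond big_mkcond; apply: lee_sum => k _.
  by case: ifP.
apply: (@le_trans _ _ ((m.+1%:R * D)%:E + (4 * D)%:E * (m.+1%:R * (1 + C))%:E)).
  by apply: leeD2l; apply: lee_wpmul2l; rewrite ?lee_fin ?mulr_ge0.
rewrite -EFinM -EFinD lee_fin -subr_ge0.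
rewrite [leRHS](_ : _ = m.+1%:R * D * C)%R; last by ring.
by rewrite !mulr_ge0.
Qed.

End exchange.

Section joint_law.
Context (d : measure_display) (T : measurableType d) (R : realType) (n : nat)
  (dO : measure_display) (O : measurableType dO) (Pr : probability O R)
  (X : 'I_n -> {RV Pr >-> T}).

Definition joint_tuple w : n.-tuple T := [tuple X i w | i < n].

Lemma measurable_joint_tuple : measurable_fun setT joint_tuple.
Proof.
apply/measurable_fun_tnthP => i.
under [X in measurable_fun _ X]eq_fun do rewrite /= tnth_mktuple.
exact: measurable_funPT.
Qed.

HB.instance Definition _ :=
  isMeasurableFun.Build _ _ _ _ joint_tuple measurable_joint_tuple.

Definition joint_law : probability (n.-tuple T) R := distribution Pr joint_tuple.

Lemma joint_lawP (P : 'I_n -> probability T R) :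
  (forall i B, measurable B -> distribution Pr (X i) B = P i B) ->
  mutually_independent X -> product_law joint_law P.
Proof.
move=> XP indX B mB; have := indX [set: 'I_n]%SET B mB.
rewrite (eq_bigl xpredT) => [|i]; last by rewrite inE.
rewrite (eq_bigr (fun i => P i (B i))) => [<-|i _]; last exact: XP.
rewrite /joint_law /distribution /pushforward; congr (Pr _).
apply/seteqP; split => w /= Bw.
  by move=> i _; have := Bw i; rewrite tnth_mktuple.
by move=> i; rewrite tnth_mktuple; apply: Bw; rewrite /= inE.
Qed.

Context (dA : measure_display) (A : measurableType dA) (Theta : Type)
  (ell : Theta -> A -> R) (theta : n.-tuple Theta).
Hypotheses (mell : forall t, measurable_fun setT (ell t))
  (ell0 : forall t a, (0 <= ell t a)%R).

Lemma risk_sum (that : decision_rule T A n) : measurable_fun setT that ->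
  risk ell theta X that = (n%:R^-1 : R)%R%:E *
    \sum_(i < n) \int[joint_law]_x (ell (tnth theta i) (tnth (that x) i))%:E.
Proof.
move=> mthat.
have mi i : measurable_fun setT (fun x => (ell (tnth theta i) (tnth (that x) i))%:E).
  apply/measurable_EFinP; apply: measurableT_comp => //.
  exact: measurableT_comp (measurable_tnth i) mthat.
have i0 i x : 0 <= (ell (tnth theta i) (tnth (that x) i))%:E by rewrite lee_fin.
rewrite -ge0_integral_sum// -ge0_integralZl_EFin//; last 2 first.
- by move=> x _; exact: sume_ge0.
- exact: emeasurable_sum.
rewrite ge0_integral_distribution//; last 2 first.
- by apply: emeasurable_funM => //; exact: emeasurable_sum.
- by move=> x; rewrite mule_ge0// sume_ge0.
rewrite /risk unlock; apply: eq_integral => w _ /=.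
by rewrite /compound_loss EFinM -sumEFin.
Qed.

Lemma risk_ge0 (that : decision_rule T A n) : 0 <= risk ell theta X that.
Proof.
rewrite /risk unlock; apply: integral_ge0 => w _.
by rewrite lee_fin mulr_ge0// sumr_ge0.
Qed.

End joint_law.

Section simple_vs_invariant.
Context (d : measure_display) (T : measurableType d) (R : realType) (m : nat)
  (dO : measure_display) (O : measurableType dO) (Pr : probability O R)
  (X : 'I_m.+1 -> {RV Pr >-> T})
  (dA : measure_display) (A : measurableType dA) (Theta : Type)
  (ell : Theta -> A -> R) (theta : m.+1.-tuple Theta)
  (P : 'I_m.+1 -> probability T R) (M : R).
Hypotheses (mell : forall t, measurable_fun setT (ell t))
  (ellM : forall t a, (0 <= ell t a <= M)%R)
  (XP : forall i B, measurable B -> distribution Pr (X i) B = P i B)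
  (indX : mutually_independent X).
Variable that : decision_rule T A m.+1.
Hypothesis thatPI : PI_rules that.

Let ell0 t a : (0 <= ell t a)%R. Proof. by case/andP: (ellM t a). Qed.
Let mu := joint_law X.
Let muP : product_law mu P. Proof. exact: joint_lawP. Qed.
Let mthat : measurable_fun setT that. Proof. by case: thatPI. Qed.

Let h i x := ell (tnth theta i) (tnth (that x) ord0).

Let mh i : measurable_fun setT (h i).
Proof.
apply: measurableT_comp => //.
exact: measurableT_comp (measurable_tnth ord0) mthat.
Qed.

Let hsym i : symmetric_off0 (h i).
Proof.
move=> j k x j0 k0; rewrite /h (proj2 thatPI) /permute tnth_mktuple.
by rewrite tpermD// eq_sym.
Qed.

Lemma PI_risk_sum : risk ell theta X that = (m.+1%:R^-1 : R)%R%:E *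
  \sum_(i < m.+1) \int[mu]_x (h i (permute (tperm ord0 i) x))%:E.
Proof.
rewrite risk_sum//; congr (_ * _); apply: eq_bigr => i _.
apply: eq_integral => x _.
by rewrite /h (proj2 thatPI) /permute tnth_mktuple tpermL.
Qed.

(* Averaging over [x] the risks of the simple rules
   [t |-> that_0 (t, x_1, .., x_m)]. *)
Lemma simple_risk_le_sum : simple_risk ell theta X <= (m.+1%:R^-1 : R)%R%:E *
  \sum_(i < m.+1) \int[resample mu ord0 (P i)]_x (h i x)%:E.
Proof.
have mEh i : measurable_fun setT (fun x => (h i x)%:E) by exact/measurable_EFinP.
have Eh0 i x : 0 <= (h i x)%:E by rewrite lee_fin; exact: ell0.
under eq_bigr do rewrite resample_integral//.
have mint i : measurable_fun setT (fun x => \int[P i]_t (h i (upd x ord0 t))%:E).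
  apply: (@measurable_fun_fubini_tonelli_F _ _ _ _ _ (P i)
    ((fun x => (h i x)%:E) \o @upd_pair _ T m.+1 ord0)) => //=.
  exact: measurableT_comp.
have int0 i x : 0 <= \int[P i]_t (h i (upd x ord0 t))%:E by exact: integral_ge0.
rewrite -ge0_integral_sum// -ge0_integralZl_EFin//; last 2 first.
- by move=> x _; exact: sume_ge0.
- exact: emeasurable_sum.
have simple0 : 0 <= simple_risk ell theta X.
  by apply: le_ereal_inf_tmp => _ [r _ <-]; exact: risk_ge0.
rewrite -[leLHS](probability_integral_cst mu); apply: ge0_le_integralT => // x.
pose Delta t := tnth (that (upd x ord0 t)) ord0.
have mDelta : measurable_fun setT Delta.
  apply: measurableT_comp (measurable_tnth ord0) _.
  exact: measurableT_comp mthat (measurable_upd1 x ord0).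
pose rule : decision_rule T A m.+1 := map_tuple Delta.
have mrule : measurable_fun setT rule.
  apply/measurable_fun_tnthP => i.
  under [X in measurable_fun _ X]eq_fun do rewrite /= tnth_map.
  exact: measurable_tnth_comp.
apply: ge_ereal_inf; exists (risk ell theta X rule).
  by exists rule => //; exists Delta.
rewrite risk_sum// le_eqVlt; apply/orP; left; apply/eqP; congr (_ * _).
apply: eq_bigr => i _.
rewrite -(@marginal_integral _ _ _ _ _ _ i (fun t => (h i (upd x ord0 t))%:E) muP)//.
  by apply: eq_integral => y _; rewrite tnth_map.
exact: measurableT_comp (mEh i) (measurable_upd1 x ord0).
Qed.

Lemma simple_risk_le (F : set (probability T R)) (D C K : R) :
  (forall k, F (P k)) -> (forall a b, chi2 (P a) (P b) <= D%:E) ->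
  chi2_capacity F <= C%:E -> (0 <= C)%R -> (0 <= K)%R ->
  ((0 < m)%N ->
   M / 2 * Num.sqrt (5 * m.+1%:R * D * (1 + C)) <= m%:R * K)%R ->
  simple_risk ell theta X <= risk ell theta X that + K%:E.
Proof.
move=> FP chiD FC C0 K0 MK; apply: (le_trans simple_risk_le_sum).
rewrite PI_risk_sum.
have hM i x : (0 <= h i x <= M)%R by exact: ellM.
have int_fin i (nu : probability (m.+1.-tuple T) R) (g : m.+1.-tuple T -> m.+1.-tuple T) :
    exists a, \int[nu]_x (h i (g x))%:E = a%:E.
  exists (fine (\int[nu]_x (h i (g x))%:E)).
  rewrite fineK// ge0_fin_numE; last first.
    by apply: integral_ge0 => x _; rewrite lee_fin; case/andP: (hM i (g x)).
  apply: (@le_lt_trans _ _ (\int[nu]_x M%:E)).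
    by apply: ge0_le_integralT => x; rewrite lee_fin; case/andP: (hM i (g x)).
  by rewrite probability_integral_cst ltry.
have /choice[a aE] i := int_fin i mu (permute (tperm ord0 i)).
have /choice[b bE] i := int_fin i (resample mu ord0 (P i)) id.
rewrite (eq_bigr _ (fun i _ => bE i)) (eq_bigr _ (fun i _ => aE i)).
rewrite !sumEFin -!EFinM -EFinD lee_fin.
rewrite -(ler_pM2l (ltr0Sn R m)) mulrDr !mulrA divff// !mul1r.
rewrite mulr_natl -[X in (K *+ X)%R]card_ord -sumr_const -big_split/=.
apply: ler_sum => i _; rewrite -lerBlDl.
have [i0|i0] := eqVneq i ord0.
  suff -> : b i = a i by rewrite subrr.
  apply: EFin_inj; rewrite -aE -bE i0 tperm1.
  have := resample_law ord0 (P ord0) muP.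
  rewrite (_ : upd_family _ _ _ = P) => [mu0P|].
    rewrite (product_law_integral _ mu0P muP); apply: eq_integral => x _.
    by congr (h _ _)%:E; apply: eq_from_tnth => j; rewrite tnth_mktuple perm1.
  by apply/funext => j; rewrite /upd_family; case: eqP => // ->.
have m0 : (0 < m)%N.
  by case: (m) i i0 => // i; rewrite (ord1 i) eqxx.
have := exchange_le FP chiD FC C0 muP i0 (mh i) (hM i) (@hsym i) (aE i) (bE i).
by move=> /le_trans/(_ (MK m0)); rewrite ler_pM2l// ltr0n.
Qed.

End simple_vs_invariant.

Local Close Scope ereal_scope.

Theorem lemma2p3 (R : realType)
  (dT : measure_display) (T : measurableType dT)
  (dA : measure_display) (A : measurableType dA)
  (Theta : Type) (P : Theta -> probability T R)
  (F : set (probability T R)) (hD : (chi2_diameter F < +oo)%E)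
  (n : nat) (hn : (0 < n)%N)
  (theta : n.-tuple Theta) (hF : forall i : 'I_n, F (P (tnth theta i)))
  (dO : measure_display) (O : measurableType dO) (Pr : probability O R)
  (X : 'I_n -> {RV Pr >-> T})
  (hX : forall (i : 'I_n) (B : set T), measurable B ->
     distribution Pr (X i) B = P (tnth theta i) B)
  (hind : mutually_independent X)
  (ell : Theta -> A -> R) (M : R)
  (mell : forall t : Theta, measurable_fun setT (ell t))
  (hell : forall (t : Theta) (a : A), 0 <= ell t a <= M) :
  (simple_risk ell theta X - PI_risk ell theta X <=
    (M * Num.sqrt (6 * fine (chi2_diameter F) *
           (expR 1 * fine (hellinger_Delta F)) `^
             (3 * fine (chi2_capacity F)) / n%:R))%:E)%E.
Proof.
case: n hn theta hF X hX hind => // m _ theta hF X hX hind.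
have F0 : F !=set0 by exists (P (tnth theta ord0)); exact: hF.
have [P0 FP0] := F0.
have D0 : (0 <= chi2_diameter F)%E.
  by rewrite (le_trans _ (chi2_le_diameter FP0 FP0))// chi2_ge0.
have Dfin : chi2_diameter F \is a fin_num by rewrite ge0_fin_numE.
have C0 : (0 <= chi2_capacity F)%E.
  pose rho : probability (pprobability T R) R :=
    uniform_prior (fun _ : 'I_1 => P0).
  apply: (@le_trans _ _ (\int[rho]_S chi2 S (mixture rho))%E).
    by apply: integral_ge0 => S _; exact: chi2_ge0.
  by apply: ereal_sup_ubound; exists rho => //; exact: uniform_prior_on.
have Cfin : chi2_capacity F \is a fin_num.
  by rewrite ge0_fin_numE// chi2_capacity_lty.
have Delta1 := hellinger_Delta_ge1 F0 hD.
set D := fine (chi2_diameter F); set C := fine (chi2_capacity F).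
set E := (_ `^ _)%R; set K := (M * _)%R.
have {}D0 : (0 <= D)%R by rewrite fine_ge0.
have {}C0 : (0 <= C)%R by rewrite fine_ge0.
have M0 : (0 <= M)%R.
  by have /andP[/le_trans] := hell (tnth theta ord0) point; apply.
have E1 : (1 + C <= E)%R.
  have : (expR (3 * C) <= E)%R.
    rewrite -[(3 * C)%R]mul1r expRM ge0_ler_powR ?nnegrE ?expR_ge0 ?mulr_ge0//.
    - by rewrite (le_trans _ Delta1).
    - by rewrite ler_peMr// expR_ge0.
  apply: le_trans; apply: le_trans (expR_ge1Dx _); lra.
have E0 : (0 <= E)%R by exact: powR_ge0.
have K0 : (0 <= K)%R by rewrite mulr_ge0// sqrtr_ge0.
have MK : (0 < m)%N ->
    (M / 2 * Num.sqrt (5 * m.+1%:R * D * (1 + C)) <= m%:R * K)%R.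
  move=> m0; rewrite /K -mulrA [leRHS]mulrCA ler_wpM2l//.
  rewrite -ler_sqr ?nnegrE ?mulr_ge0 ?sqrtr_ge0// !exprMn !sqr_sqrtr; last 2 first.
  - by rewrite divr_ge0// !mulr_ge0.
  - by rewrite !mulr_ge0// addr_ge0.
  have m1 : (1 <= m%:R :> R)%R by rewrite ler1n.
  rewrite -[m.+1%:R%R]natr1; set x := m%:R%R in m1 *.
  have x1 : (0 < x + 1)%R by lra.
  rewrite [leRHS]mulrA ler_pdivlMr//.
  have H1 : (0 <= D * (E - (1 + C)))%R by rewrite mulr_ge0// subr_ge0.
  have H2 : (0 <= D * (1 + C))%R by rewrite mulr_ge0// addr_ge0.
  have H3 : (0 <= x ^+ 2 * (D * (E - (1 + C))))%R by rewrite mulr_ge0// sqr_ge0.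
  have H4 : (0 <= (24 * x ^+ 2 - 5 * (x + 1) ^+ 2) * (D * (1 + C)))%R.
    by rewrite mulr_ge0//; nra.
  lra.
have key that : PI_rules that ->
    (simple_risk ell theta X <= risk ell theta X that + K%:E)%E.
  move=> thatPI.
  apply: (@simple_risk_le _ _ _ _ _ _ _ _ _ _ _ _ _ (P \o tnth theta) M mell hell
    hX hind that thatPI F D C) => //.
  - by move=> a b; rewrite fineK//; apply: chi2_le_diameter; exact: hF.
  - by rewrite fineK.
have PI0 : (0 <= PI_risk ell theta X)%E.
  apply: le_ereal_inf_tmp => _ [r _ <-]; apply: risk_ge0 => t a.
  by case/andP: (hell t a).
have SPI : (simple_risk ell theta X - K%:E <= PI_risk ell theta X)%E.
  by apply: le_ereal_inf_tmp => _ [r rPI <-]; rewrite leeBlDr//; exact: key.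
move: PI0 SPI; case: (PI_risk _ _ _) => // [p _|_ _].
  by rewrite !leeBlDr// addeC.
by rewrite addeNy leNye.
Qed.
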